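(* Let $g\in G$ and $\theta\in\Theta_+$. Then the map $g:(\mathcal I,d_\theta)\to(\mathcal I,d_\theta)$, $x\mapsto g.x$, is Lipschitz.
   Context: **Vectorial data.** $I$ is a finite set and $C=(c_{i,j})_{i,j\in I}$ is a Kac--Moody matrix: $c_{i,j}\in\mathbb Z$, $c_{i,i}=2$, $c_{i,j}\le 0$ for $i\neq j$, and $c_{i,j}=0\iff c_{j,i}=0$. $X,Y$ are dual free $\mathbb Z$-modules of finite rank with $\mathbb Z$-linearly independent families $(\alpha_i)_{i\in I}$ in $X$ and $(\alpha_i^\vee)_{i\in I}$ in $Y$ such that $\alpha_j(\alpha_i^\vee)=c_{i,j}$. $\mathbb A=Y\otimes\mathbb R$, with its usual topology; elements of $X$ are linear forms on $\mathbb A$. $r_i(v)=v-\alpha_i(v)\alpha_i^\vee$, and $W^v=\langle r_i\mid i\in I\rangle\subset \mathrm{GL}(\mathbb A)$ (Weyl group), acting on $\mathbb A^*$ by $(w.\alpha)(x)=\alpha(w^{-1}x)$. $\Phi=\{w.\alpha_i\}$ is the set of real roots; for $\alpha=w.\alpha_i\in\Phi$, $\alpha^\vee=w.\alpha_i^\vee$. $Q^\vee=\bigoplus_i\mathbb Z\alpha_i^\vee$ and $W^a=Q^\vee\rtimes W^v$. $\Delta\subset\bigoplus_i\mathbb Z\alpha_i\subset\mathbb A^*$ is the set of all (real and imaginary) roots of the Kac--Moody algebra of $C$. For $\alpha\in\mathbb A^*$, $k\in\mathbb R$: $D(\alpha,k)=\{\alpha(x)+k\ge0\}$, $D^\circ(\alpha,k)=\{\alpha(x)+k>0\}$,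 $M(\alpha,k)=\{\alpha(x)+k=0\}$, and $D(\alpha,+\infty)=D^\circ(\alpha,+\infty)=\mathbb A$. Walls (resp. half-apartments) are the $M(\alpha,k)$ (resp. $D(\alpha,k)$), $\alpha\in\Phi$, $k\in\mathbb Z$. $C^v_f=\{v\mid\alpha_i(v)>0\ \forall i\}$; for $J\subset I$, $F^v(J)=\{v\mid \alpha_i(v)=0\ (i\in J),\ \alpha_i(v)>0\ (i\notin J)\}$. Positive (resp. negative) vectorial faces are the $w.F^v(J)$ (resp. $-w.F^v(J)$), $w\in W^v$; vectorial chambers are the $\pm w.C^v_f$. Tits cone: $\mathcal T=\bigcup_{w}w.\overline{C^v_f}$. A vectorial face is spherical if it meets $\pm\mathring{\mathcal T}$. $x\le y$ means $y-x\in\mathcal T$. A ray or segment through $x\ne y$ from $x$ is preordered if $x\le y$ or $y\le x$, generic if $y-x\in\pm\mathring{\mathcal T}$. **Filters.** A filter lies in a set $Z$ if $Z$ is an element of it; a set (e.g. an apartment) contains a filter if it contains an element of it; a map fixes a filter if it fixes pointwise some element of it. The support of a filter is the smallest affine subspace containing it. $\mathcal F\Cup\mathcal F'=\{E\cup E'\mid E\in\mathcal F,E'\in\mathcal F'\}$. The enclosure $\mathrm{cl}(\mathcal F)$ of a filter on $\mathbb A$ is the filter of sets $E$ containing some $\bigcap_{\alpha\in\Delta}D(\alpha,k_\alpha)\in\mathcal F$ with $k_\alpha\in\mathbb Z\cup\{+\infty\}$ (a set is treated as its principal filter). A sector-face is $f=x+F^v$ ($F^v$ a vectorial face); its germ at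 infinity is the filter of sets containing $x+u+F^v$ for some $u\in\overline{F^v}$. If $F^v$ is a vectorial chamber, $f$ is a sector and its germ is a sector-germ, with the sign of $F^v$; $\pm\infty$ is the germ of $\pm C^v_f$. The face $F(x,F^v)$ is the filter of sets $E$ for which there are $k_\alpha,k'_\alpha\in\mathbb Z\cup\{+\infty\}$ $(\alpha\in\Delta)$ and a neighbourhood $\Omega$ of $x$ with $E\supset\bigcap_{\alpha}(D(\alpha,k_\alpha)\cap D^\circ(\alpha,k'_\alpha))\supset\Omega\cap(x+F^v)$. A chamber (resp. panel) is a face with support $\mathbb A$ (resp. a wall). A chimney is $\mathfrak r(F,F^v)=\mathrm{cl}(F+F^v)$, $F$ a face, $F^v$ a vectorial face; it is splayed if $F^v$ is spherical, solid if the pointwise stabilizer in $W^v$ of the direction of its support is finite. Its germ is the filter of sets belonging to some $\mathfrak r(F+u,F^v)$, $u\in\overline{F^v}$. **Apartments.** $\mathrm{Aut}(\mathbb A)$ is the group of affine bijections of $\mathbb A$ stabilizing $\{(M(\alpha,k),\alpha^\vee)\mid\alpha\in\Phi,k\in\mathbb Z\}$. An apartment of type $\mathbb A$ is a set $A$ with a nonempty set $\mathrm{Isom}^w(\mathbb A,A)$ of bijections $\mathbb A\to A$ forming one orbit $f_0\circ W^a$. A bijection $\phi:A\to A'$ is a Weyl isomorphism (resp. an isomorphism, which here always means vectorially Weyl isomorphism) if $f'^{-1}\circ\phi\circ f\in W^a$ (resp. $\in(W^v\ltimes\mathbb A)\cap\mathrm{Aut}(\mathbb A)$) for $f\in\mathrm{Isom}^w(\mathbb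 A,A)$, $f'\in\mathrm{Isom}^w(\mathbb A,A')$. All above notions, the affine structure and the affine topology are transported to every apartment. **Masure.** A masure of type $\mathbb A$ is a set $\mathcal I$ covered by a family of subsets called apartments such that: (MA1) each apartment has a structure of apartment of type $\mathbb A$. (MA2) If $F$ is a point, a germ of a preordered interval, a generic ray or a solid chimney in an apartment $A$, and $A'$ is another apartment containing $F$, then $A\cap A'$ contains $\mathrm{cl}_A(F)$ and there is a Weyl isomorphism $A\to A'$ fixing $\mathrm{cl}_A(F)$. (MA3) If $\mathfrak R$ is the germ of a splayed chimney and $F$ is a face or a germ of a solid chimney, some apartment contains $\mathfrak R$ and $F$. (MA4) If apartments $A,A'$ contain $\mathfrak R$ and $F$ as in (MA3), there is a Weyl isomorphism $A\to A'$ fixing $\mathrm{cl}_A(\mathfrak R\Cup F)$. (MAO) If $x,y\in A\cap A'$ and $x\le_A y$ then $[x,y]_A=[x,y]_{A'}$. Standing assumptions: $\mathcal I$ is such a masure; each panel lies in the closure of finitely many, and more than $2$, chambers; a group $G$ acts strongly transitively on $\mathcal I$ (it permutes apartments, each $g:A\to g.A$ is an isomorphism of apartments, and all isomorphisms in the axioms are induced by elements of $G$); $\mathbb A$ is identified with a fixed apartment of $\mathcal I$, and the stabilizer of $\mathbb A$ in $G$ induces on $\mathbb A$ the group $W^v\ltimes Y$. $\mathcal I$ is a building if and only if $W^v$ is finite. Sector-germs of $\mathcal I$ are sector-germs of its apartments (a sector-germ contained in an apartment $B$ is a sector-germ of $B$, of the same sign). **Distances.** Let $\mathfrak s$ be a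 sector-germ of sign $\mathrm{sgn}(\mathfrak s)\in\{+,-\}$, $x\in\mathcal I$, $u\in\overline{C^v_f}$. Choose an apartment $A_1$ containing $x$ and $\mathfrak s$ and an isomorphism $\psi:\mathbb A\to A_1$ with $\psi(\mathrm{sgn}(\mathfrak s)\infty)=\mathfrak s$; then $x+_{\mathfrak s}u:=\psi(\psi^{-1}(x)+\mathrm{sgn}(\mathfrak s)u)$ is independent of choices. $U_{\mathfrak s}(x,x')=\{(u,u')\in\overline{C^v_f}^2\mid x+_{\mathfrak s}u=x'+_{\mathfrak s}u'\}$, which is nonempty. $\Theta_+$ (resp. $\Theta_-$) is the set of pairs $\theta=(|\cdot|,\mathfrak s)$ with $|\cdot|$ a norm on $\mathbb A$ and $\mathfrak s$ a positive (resp. negative) sector-germ of $\mathcal I$. For such $\theta$, $d_\theta(x,x')=\inf\{|u|+|u'|\mid(u,u')\in U_{\mathfrak s}(x,x')\}$ is a distance on $\mathcal I$. *)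

(* Defs.v *)
From HB Require Import structures.
From mathcomp Require Import all_boot all_order all_algebra.
From mathcomp Require Import all_classical all_reals all_analysis.
From mathcomp Require Import complex.
Set Implicit Arguments.
Unset Strict Implicit.
Unset Printing Implicit Defensive.
Import Order.TTheory GRing.Theory Num.Theory.
Import numFieldNormedType.Exports.
Local Open Scope classical_set_scope.
Local Open Scope ring_scope.

(* Bases of the dual free modules Y and X are fixed: Y is Z^d as row vectors,
   X is Z^d as column vectors, and the pairing of y and x is the scalar y *m x. *)
Record root_datum (I : finType) (d : nat) := RootDatum {
  cartan : I -> I -> int;
  simple_root : I -> 'cV[int]_d;
  simple_coroot : I -> 'rV[int]_d;
  cartan_diag : forall i, cartan i i = 2;
  cartan_le0 : forall i j, i != j -> cartan i j <= 0;
  cartan_eq0 : forall i j, cartan i j = 0 <-> cartan j i = 0;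
  root_free : forall n : I -> int,
    \sum_i n i *: simple_root i = 0 -> forall i, n i = 0;
  coroot_free : forall n : I -> int,
    \sum_i n i *: simple_coroot i = 0 -> forall i, n i = 0;
  root_coroot : forall i j, (simple_coroot i *m simple_root j) 0 0 = cartan i j }.

(* V. Kac, Infinite dimensional Lie algebras, 1.2-1.4: the Kac-Moody algebra of
   C is, up to isomorphism, the Lie algebra generated by a minimal realization
   (h, alpha_i, alpha_i^vee) of C and the e_i, f_i, subject to the relations
   below, in which no nonzero ideal meets h trivially. *)
Record kac_moody_algebra (K : fieldType) (I : finType) (C : I -> I -> int) :=
  KacMoodyAlgebra {
  km_sort : lmodType K;
  km_br : km_sort -> km_sort -> km_sort;
  km_br_linearl : forall y (a : K) x x',
    km_br (a *: x + x') y = a *: km_br x y + km_br x' y;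
  km_br_linearr : forall x (a : K) y y',
    km_br x (a *: y + y') = a *: km_br x y + km_br x y';
  km_brxx : forall x, km_br x x = 0;
  km_jacobi : forall x y z,
    km_br x (km_br y z) + km_br y (km_br z x) + km_br z (km_br x y) = 0;
  km_h : vectType K;
  km_inj : {linear km_h -> km_sort};
  km_inj_inj : injective km_inj;
  km_root : I -> 'Hom(km_h, K^o);
  km_coroot : I -> km_h;
  km_root_free : free [seq km_root i | i : I];
  km_coroot_free : free [seq km_coroot i | i : I];
  km_root_coroot : forall i j, km_root j (km_coroot i) = (C i j)%:~R;
  km_dim : (\dim (fullv : {vspace km_h}) +
    \rank (\matrix_(i < #|I|, j < #|I|) (C (enum_val i) (enum_val j))%:~R : 'M[K]_#|I|)
      = 2 * #|I|)%N;
  km_e : I -> km_sort;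
  km_f : I -> km_sort;
  km_ef : forall i j,
    km_br (km_e i) (km_f j) = if i == j then km_inj (km_coroot i) else 0;
  km_hh : forall h h', km_br (km_inj h) (km_inj h') = 0;
  km_he : forall h i, km_br (km_inj h) (km_e i) = km_root i h *: km_e i;
  km_hf : forall h i, km_br (km_inj h) (km_f i) = - km_root i h *: km_f i;
  km_generated : forall P : set km_sort,
    (forall h, P (km_inj h)) -> (forall i, P (km_e i)) -> (forall i, P (km_f i)) ->
    (forall (a : K) x y, P x -> P y -> P (a *: x + y)) ->
    (forall x y, P x -> P y -> P (km_br x y)) ->
    forall x, P x;
  km_no_ideal : forall J : set km_sort,
    J 0 -> (forall (a : K) x y, J x -> J y -> J (a *: x + y)) ->
    (forall x y, J y -> J (km_br x y)) ->
    (forall h, J (km_inj h) -> km_inj h = 0) ->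
    forall x, J x -> x = 0 }.

(* [n] is the coordinate vector, in the basis of simple roots, of a root: a
   nonzero weight of h whose weight space is nonzero. *)
Definition km_is_root (K : fieldType) (I : finType) (C : I -> I -> int)
    (L : kac_moody_algebra K C) (n : I -> int) : Prop :=
  (exists i, n i != 0) /\
  exists2 x : km_sort L, x != 0 &
    forall h : km_h L,
      km_br (km_inj L h) x = (\sum_i (n i)%:~R * (km_root L i h : K)) *: x.

Section Apartment.
Variables (R : realType) (I : finType) (d : nat) (D : root_datum I d).
Variable (L : kac_moody_algebra R[i] (cartan D)).

Local Notation A := 'rV[R]_d.
Local Notation Adual := 'cV[R]_d.

Definition ev (x : A) (a : Adual) : R := (x *m a) 0 0.
Definition rootR i : Adual := map_mx intr (simple_root D i).
Definition corootR i : A := map_mx intr (simple_coroot D i).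
Definition refl i (v : A) : A := v - ev v (rootR i) *: corootR i.

(* The reflections are involutions, so they generate a group as a monoid. *)
Inductive weyl : set (A -> A) :=
| weyl_id : weyl id
| weyl_refl i w : weyl w -> weyl (refl i \o w).

(* The pairs (w.alpha_i, w.alpha_i^vee); the first condition reads
   (w.alpha_i)(w x) = alpha_i x. *)
Definition real_root : set (Adual * A) :=
  [set p | exists w i, [/\ weyl w,
     forall x, ev (w x) p.1 = ev x (rootR i) & p.2 = w (corootR i)]].

Definition all_roots : set Adual :=
  [set \sum_i rootR i *~ n i | n in km_is_root L].


(* The affine maps with linear part in W^v and translation part in [tr]. *)
Definition weyl_ext (tr : set A) : set (A -> A) :=
  [set h | exists w t, [/\ weyl w, tr t & h = fun x => w x + t]].
Definition coroot_lattice : set A :=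
  [set \sum_i corootR i *~ n i | n in [set: I -> int]].
Definition lattice_Y : set A := [set map_mx intr y | y in [set: 'rV[int]_d]].
Definition affine_weyl : set (A -> A) := weyl_ext coroot_lattice.

(* [None] stands for k = +oo. *)
Definition closed_half (a : Adual) (k : option int) : set A :=
  [set x | if k is Some k' then 0 <= ev x a + k'%:~R else True].
Definition open_half (a : Adual) (k : option int) : set A :=
  [set x | if k is Some k' then 0 < ev x a + k'%:~R else True].
Definition wall (a : Adual) (k : int) : set A := [set x | ev x a + k%:~R = 0].

Definition wall_data : set (set A * A) :=
  [set q | exists p k, real_root p /\ q = (wall p.1 k, p.2)].
Definition aut_apartment : set (A -> A) :=
  [set h | exists (M : 'M[R]_d) (b : A),
     [/\ M \in unitmx, h = fun x => x *m M + b
       & [set (h @` q.1, q.2 *m M) | q in wall_data] = wall_data]].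
Definition vw_aut : set (A -> A) := weyl_ext setT `&` aut_apartment.

Definition sgn (e : bool) : R := if e then 1 else -1.

Definition fund_chamber : set A := [set v | forall i, 0 < ev v (rootR i)].
Definition fund_face (J : {set I}) : set A :=
  [set v | forall i, if i \in J then ev v (rootR i) = 0 else 0 < ev v (rootR i)].
(* The sign is positive for [e = true]. *)
Definition vect_face (e : bool) : set (set A) :=
  [set V | exists w J, weyl w /\ V = [set sgn e *: w v | v in fund_face J]].
Definition vect_chamber (e : bool) : set (set A) :=
  [set V | exists w, weyl w /\ V = [set sgn e *: w v | v in fund_chamber]].

Definition tits_cone : set A :=
  [set x | exists w v, [/\ weyl w, closure fund_chamber v & x = w v]].
Definition open_tits_cone_pm : set A :=
  [set x | interior tits_cone x \/ interior tits_cone (- x)].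
Definition spherical (V : set A) : Prop := V `&` open_tits_cone_pm !=set0.
Definition tits_le (x y : A) : Prop := tits_cone (y - x).

Definition segment (x y : A) : set A :=
  [set x + t *: (y - x) | t in [set t : R | 0 <= t <= 1]].
Definition ray (x y : A) : set A :=
  [set x + t *: (y - x) | t in [set t : R | 0 <= t]].

Definition affine_subspace (S : set A) : Prop :=
  S !=set0 /\ forall x y z (t : R), S x -> S y -> S z -> S (x + t *: (y - z)).
Definition is_support (F : set_system A) (S : set A) : Prop :=
  [/\ affine_subspace S, F S &
      forall S', affine_subspace S' -> F S' -> S `<=` S'].

(* A set is turned into a filter by [globally]. *)
Definition enclosure (F : set_system A) : set_system A :=
  [set E | exists2 k : Adual -> option int,
     F (\bigcap_(a in all_roots) closed_half a (k a)) &
     \bigcap_(a in all_roots) closed_half a (k a) `<=` E].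

Definition filter_add (F : set_system A) (S : set A) : set_system A :=
  [set E | exists2 E0, F E0 & [set x + v | x in E0 & v in S] `<=` E].
Definition filter_closure (F : set_system A) : set_system A :=
  [set E | exists2 E0, F E0 & closure E0 `<=` E].

Definition sector_face_germ (x : A) (V : set A) : set_system A :=
  [set E | exists2 u, closure V u & [set x + u + v | v in V] `<=` E].
Definition infty (e : bool) : set_system A :=
  sector_face_germ 0 [set sgn e *: v | v in fund_chamber].

Definition face (x : A) (V : set A) : set_system A :=
  [set E | exists (k k' : Adual -> option int) (O : set A),
     [/\ nbhs x O,
         \bigcap_(a in all_roots) (closed_half a (k a) `&` open_half a (k' a)) `<=` E &
         O `&` [set x + v | v in V] `<=`
           \bigcap_(a in all_roots) (closed_half a (k a) `&` open_half a (k' a))]].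
Definition is_face (F : set_system A) : Prop :=
  exists x e V, vect_face e V /\ F = face x V.
Definition is_chamber (F : set_system A) : Prop := is_face F /\ is_support F setT.
Definition is_panel (F : set_system A) : Prop :=
  is_face F /\ exists p k, real_root p /\ is_support F (wall p.1 k).

Definition chimney (F : set_system A) (V : set A) : set_system A :=
  enclosure (filter_add F V).
Definition solid (F : set_system A) (V : set A) : Prop :=
  exists2 S, is_support (chimney F V) S &
    finite_set [set w | weyl w /\ forall x y, S x -> S y -> w (y - x) = y - x].
Definition chimney_germ (F : set_system A) (V : set A) : set_system A :=
  [set E | exists2 u, closure V u & chimney (filter_add F [set u]) V E].

Definition splayed_chimney_germ : set (set_system A) :=
  [set Q | exists F e V, [/\ is_face F, vect_face e V, spherical V &
                             Q = chimney_germ F V]].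
Definition solid_chimney_germ : set (set_system A) :=
  [set Q | exists F e V, [/\ is_face F, vect_face e V, solid F V &
                             Q = chimney_germ F V]].

Definition segment_germ (x y : A) : set_system A :=
  [set E | exists2 O, nbhs x O & O `&` segment x y `<=` E].

Inductive ma2_filter : set (set_system A) :=
| ma2_point x : ma2_filter (globally [set x])
| ma2_segment_germ x y : x != y -> tits_le x y \/ tits_le y x ->
    ma2_filter (segment_germ x y)
| ma2_generic_ray x y : x != y -> open_tits_cone_pm (y - x) ->
    ma2_filter (globally (ray x y))
| ma2_solid_chimney F e V : is_face F -> vect_face e V -> solid F V ->
    ma2_filter (chimney F V).

(* [isomw B] is Isom^w(A, B), whose elements are seen as injections into the
   ambient set with range B. A filter of B is represented by the filter
   [fmap f F] it generates in the ambient set, for f in Isom^w(A, B); a set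
   contains it if and only if it is an element of it. *)
Record apartment_system := ApartmentSystem {
  pt :> Type;
  apt : set (set pt);
  isomw : set pt -> set (A -> pt);
  apt_cover : forall x, exists2 B, apt B & B x;
  ma1 : forall B, apt B -> exists f0,
    [/\ injective f0, range f0 = B &
        isomw B = [set f0 \o w | w in affine_weyl]] }.

Section ApartmentSystem.
Variable S : apartment_system.

(* A bijection between apartments is given by any map of the ambient set
   extending it. *)
Definition iso_of (H : set (A -> A)) (B B' : set S) (phi : S -> S) : Prop :=
  forall f f', isomw B f -> isomw B' f' ->
    exists2 h, H h & forall x, phi (f x) = f' (h x).
Definition weyl_iso := iso_of affine_weyl.
Definition vw_iso := iso_of vw_aut.

Definition fixes (phi : S -> S) (F : set_system S) : Prop :=
  exists2 Z, F Z & forall z, Z z -> phi z = z.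

Definition filter_cup (F F' : set_system S) : set_system S :=
  [set E `|` E' | E in F & E' in F'].

(* The enclosure, in the apartment parametrized by [f], of a filter contained
   in it. *)
Definition enclosure_in (f : A -> S) (F : set_system S) : set_system S :=
  fmap f (enclosure [set f @^-1` Z | Z in F]).

Definition transported (K : set (set_system A)) : set (set_system S) :=
  [set F | exists B f F0, [/\ apt B, isomw B f, K F0 & F = fmap f F0]].

(* In MA2 and MA4, [ind] restricts the isomorphisms that may be used; it is
   [setT] in the definition of a masure. *)
Definition MA2 (ind : set (S -> S)) : Prop :=
  forall B f F0 B', apt B -> isomw B f -> ma2_filter F0 -> apt B' ->
    fmap f F0 B' ->
    enclosure_in f (fmap f F0) (B `&` B') /\
    exists phi, [/\ ind phi, weyl_iso B B' phi &
                    fixes phi (enclosure_in f (fmap f F0))].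

Definition MA3 : Prop :=
  forall Q F, transported splayed_chimney_germ Q ->
    transported (is_face `|` solid_chimney_germ) F ->
    exists B, [/\ apt B, Q B & F B].

Definition MA4 (ind : set (S -> S)) : Prop :=
  forall Q F, transported splayed_chimney_germ Q ->
    transported (is_face `|` solid_chimney_germ) F ->
    forall B B' f, apt B -> apt B' -> isomw B f -> Q B -> F B -> Q B' -> F B' ->
    exists phi, [/\ ind phi, weyl_iso B B' phi &
                    fixes phi (enclosure_in f (filter_cup Q F))].

Definition MAO : Prop :=
  forall (B B' : set S) f f' x y x' y', apt B -> apt B' -> isomw B f -> isomw B' f' ->
    f x = f' x' -> f y = f' y' -> tits_le x y ->
    f @` segment x y = f' @` segment x' y'.

End ApartmentSystem.

Record masure := Masure {
  masure_system :> apartment_system;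
  ma2 : MA2 (S := masure_system) setT;
  ma3 : MA3 masure_system;
  ma4 : MA4 (S := masure_system) setT;
  mao : MAO masure_system }.

Section Masure.
Variable M : masure.

(* The chambers whose closure contains P; a filter F is contained in a filter F'
   when F' is a subset of F. *)
Definition chambers_around (P : set_system M) : set (set_system M) :=
  [set Q | exists B f C, [/\ apt B, isomw B f, is_chamber C, Q = fmap f C &
                             fmap f (filter_closure C) `<=` P]].
Definition thick_locally_finite : Prop :=
  forall P, transported is_panel P ->
    exists n, (2 < n)%N /\ (chambers_around P #= `I_n)%card.

Record strongly_transitive (G : groupType) (act : G -> M -> M) : Prop := {
  act1 : forall x, act 1%g x = x;
  actM : forall g h x, act (g * h)%g x = act g (act h x);
  act_apt : forall g B, apt B -> apt (act g @` B);
  act_iso : forall g B, apt B -> vw_iso B (act g @` B) (act g);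
  act_ma2 : MA2 (range act);
  act_ma4 : MA4 (range act) }.

(* [iota] identifies the model apartment with the apartment A0. *)
Definition stabilizer_induces_WY (G : groupType) (act : G -> M -> M)
    (A0 : set M) (iota : A -> M) : Prop :=
  [set h : A -> A | exists2 g, act g @` A0 = A0 &
                               forall x, act g (iota x) = iota (h x)]
    = weyl_ext lattice_Y.

Definition sector_germ (e : bool) : set (set_system M) :=
  transported
    [set s | exists x V, vect_chamber e V /\ s = sector_face_germ x V].

Definition isom_from_model (B : set M) : set (A -> M) :=
  [set psi | exists f h, [/\ isomw B f, vw_aut h & psi = f \o h]].

(* z = x +_s u: a relation, as x +_s u is specified up to the choice of an
   apartment B and of an isomorphism psi. *)
Definition sector_add (e : bool) (s : set_system M) (x : M) (u : A) (z : M) : Prop :=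
  exists B psi a,
    [/\ apt B, s B, isom_from_model B psi, fmap psi (infty e) = s &
        psi a = x /\ z = psi (a + sgn e *: u)].

Definition U_set (e : bool) (s : set_system M) (x x' : M) : set (A * A) :=
  [set p | [/\ closure fund_chamber p.1, closure fund_chamber p.2 &
     exists2 z, sector_add e s x p.1 z & sector_add e s x' p.2 z]].

Definition is_norm (N : A -> R) : Prop :=
  [/\ forall x y, N (x + y) <= N x + N y,
      forall (a : R) x, N (a *: x) = `|a| * N x &
      forall x, N x = 0 -> x = 0].

Definition Theta (e : bool) : set ((A -> R) * set_system M) :=
  [set th | is_norm th.1 /\ sector_germ e th.2].

Definition dist (e : bool) (th : (A -> R) * set_system M) (x x' : M) : R :=
  inf [set th.1 p.1 + th.1 p.2 | p in U_set e th.2 x x'].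

End Masure.

End Apartment.

(* Main.v *)
(** An element g of G maps x +_s u to (g x) +_(g s) u, so it suffices to compare
the distances attached to two positive sector-germs. Two such germs lie in a common
apartment, and a gallery there reduces the comparison to germs s and s' adjacent
along a panel of type i.

For adjacent germs, follow the path t |-> x +_s (t u) and look at the local face F
of its direction at one of its points. Any apartment containing F and s' sees the
path near this point with direction u or r_i u. To prove this, consider the chimney
germs in the direction of the common panel of s and s', based at the points of an
apartment containing s and s': they move from germs lying in s to germs lying in s'.
By (MA3) and (MA4), apartments containing F and one of these germs are compared by
maps fixing the panel direction, hence with linear part 1 or r_i, and an apartment
containing F and one of these germs contains the nearby ones as well.

Since r_i u is a difference of dominant vectors of length O(|u|), the path is locally
Lipschitz for s', hence Lipschitz. *)
Require Import Defs.
From mathcomp Require Import all_boot all_order all_algebra.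
From mathcomp Require Import all_classical all_reals all_analysis.
From mathcomp Require Import complex.
From mathcomp Require Import ring lra zify.
Set Implicit Arguments.
Unset Strict Implicit.
Unset Printing Implicit Defensive.
Import Order.TTheory GRing.Theory Num.Theory.
Import numFieldNormedType.Exports.
Local Open Scope classical_set_scope.
Local Open Scope ring_scope.

(** * The Weyl group as a Coxeter group *)

Section RootDatum.
Variables (R : realType) (I : finType) (d : nat) (D : root_datum I d).
Local Notation A := 'rV[R]_d.
Local Notation al j x := (ev x (rootR R D j)).
Local Notation r := (@refl R I d D).
Local Notation weyl := (@weyl R I d D).
Local Notation weyl_id := (@weyl_id R I d D).
Local Notation cor := (corootR R D).
Local Notation c i j := ((cartan D i j)%:~R : R).

(** The obstacle is that a face and two adjacent sector-germs need not lie in a common apartment, so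
    no single transition map compares the two germs near the face. Panel chimneys get around it:
    panel directions are spherical, hence (MA3) and (MA4) apply to any face and any germ along such
    a direction, and these germs are indexed by one real height. A locally constant property of the
    height is constant; the lemma of Cousin that proves this also assembles the local estimates
    along the path, without any uniformity of the step sizes. Two preliminaries are forced by this
    plan. A transition map fixing a strip is an element of the affine Weyl group, and finding its
    linear part requires the simple transitivity of W^v on chambers, proved here from rank two
    computations. Enclosures are cut out by all roots of the Kac-Moody algebra, so sectors and their
    images under r_i are known to be enclosed only once the alpha_j and the r_i alpha_j are shown to
    be roots, by an sl2 computation. Infima are postponed to the very end: until then the relation
    [dist_le], which carries explicit witnesses, replaces the distance. *)

Lemma evD (x y : A) b : ev (x + y) b = ev x b + ev y b.
Proof. by rewrite /ev mulmxDl mxE. Qed.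
Lemma evZ t (x : A) b : ev (t *: x) b = t * ev x b.
Proof. by rewrite /ev -scalemxAl mxE. Qed.
Lemma evN (x : A) b : ev (- x) b = - ev x b.
Proof. by rewrite -scaleN1r evZ mulN1r. Qed.
Lemma evB (x y : A) b : ev (x - y) b = ev x b - ev y b.
Proof. by rewrite evD evN. Qed.
Lemma ev0 b : ev (0 : A) b = 0.
Proof. by rewrite /ev mul0mx mxE. Qed.

Definition evE := (evD, evB, evN, evZ, ev0).

Lemma evDr (x : A) b b' : ev x (b + b') = ev x b + ev x b'.
Proof. by rewrite /ev mulmxDr [LHS]mxE. Qed.
Lemma evZr t (x : A) b : ev x (t *: b) = t * ev x b.
Proof. by rewrite /ev -scalemxAr [LHS]mxE. Qed.
Lemma evNr (x : A) b : ev x (- b) = - ev x b.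
Proof. by rewrite -scaleN1r evZr mulN1r. Qed.

Lemma ev_coroot i j : al j (cor i) = c i j.
Proof.
rewrite /ev /corootR /rootR -map_mxM mxE; congr (_%:~R).
exact: root_coroot.
Qed.

Lemma ev_refl i j x : al j (r i x) = al j x - al i x * c i j.
Proof. by rewrite /refl evB evZ ev_coroot. Qed.

Lemma ev_refl_same i x : al i (r i x) = - al i x.
Proof. by rewrite ev_refl cartan_diag; ring. Qed.

Lemma reflK i : involutive (r i).
Proof.
move=> x; rewrite {1}/refl ev_refl_same /refl scaleNr opprK.
by rewrite subrK.
Qed.

Lemma reflD i x y : r i (x + y) = r i x + r i y.
Proof. by rewrite /refl evD scalerDl opprD addrACA. Qed.
Lemma reflZ i t x : r i (t *: x) = t *: r i x.
Proof. by rewrite /refl evZ scalerBr scalerA. Qed.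

Lemma weylD w : weyl w -> forall x y, w (x + y) = w x + w y.
Proof. by elim=> [|i w' _ IH] x y /=; last rewrite IH reflD. Qed.
Lemma weylZ w : weyl w -> forall t x, w (t *: x) = t *: w x.
Proof. by elim=> [|i w' _ IH] t x /=; last rewrite IH reflZ. Qed.
Lemma weylN w : weyl w -> forall x, w (- x) = - w x.
Proof. by move=> W x; rewrite -scaleN1r (weylZ W) scaleN1r. Qed.
Lemma weylB w : weyl w -> forall x y, w (x - y) = w x - w y.
Proof. by move=> W x y; rewrite (weylD W) (weylN W). Qed.
Lemma weyl0 w : weyl w -> w 0 = 0.
Proof. by move=> W; have := weylZ W 0 0; rewrite !scale0r. Qed.

Lemma weyl_comp w w' : weyl w -> weyl w' -> weyl (w \o w').
Proof.
move=> W W'; elim: W => // i w1 _ IH.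
by rewrite -compA; exact: weyl_refl.
Qed.

Lemma weyl_refl1 i : weyl (r i).
Proof. exact: (@weyl_refl R I d D i id weyl_id). Qed.

Lemma weyl_inv w : weyl w ->
  exists w', [/\ weyl w', cancel w w' & cancel w' w].
Proof.
elim=> [|i w1 _ [w' [W' K1 K2]]]; first by exists id; split=> //; exact: weyl_id.
exists (w' \o r i); split.
- exact: weyl_comp W' (weyl_refl1 i).
- by move=> x /=; rewrite reflK K1.
- by move=> x /=; rewrite K2 reflK.
Qed.

Definition word_act (s : seq I) : A -> A := foldr (fun i f => r i \o f) id s.

Lemma act_cat s t : word_act (s ++ t) = word_act s \o word_act t.
Proof. by elim: s => //= i s ->. Qed.

Lemma weyl_act w : weyl w -> exists s, word_act s = w.
Proof.
elim=> [|i w' _ [s <-]]; first by exists [::].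
by exists (i :: s).
Qed.

Fixpoint alt (i j : I) p := if p is p'.+1 then i :: alt j i p' else [::].

Lemma size_alt i j p : size (alt i j p) = p.
Proof. by elim: p i j => //= p IH i j; rewrite IH. Qed.

Lemma alt_rcons i j p :
  alt i j p.+1 = rcons (alt i j p) (if odd p then j else i).
Proof.
elim: p i j => // p IH i j; rewrite -[LHS]/(i :: alt j i p.+1) IH /=.
by case: (odd p).
Qed.

Lemma alt_cat i j p q : exists a b, alt i j (p + q) = alt i j p ++ alt a b q.
Proof.
elim: p i j => [|p IH] i j; first by exists i, j.
by have [a [b E]] := IH j i; exists a, b; rewrite addSn /= E.
Qed.

(** * Rank two: words in two simple reflections *)

Section Dihedral.
Variables (i j : I) (neq_ij : i != j).
Local Notation a := (- c i j).
Local Notation b := (- c j i).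

(** The six finite cases are the types A1 x A1, A2, B2 and G2, where r_i r_j has order 2, 3, 4, 6;
    in the last case the order is infinite. *)
Lemma cartan_cases :
  [\/ a = 0 /\ b = 0, a = 1 /\ b = 1, a = 1 /\ b = 2 |
  [\/ a = 2 /\ b = 1, a = 1 /\ b = 3, a = 3 /\ b = 1 |
      [/\ 0 < a, 0 < b & 4 <= a * b]]].
Proof.
have aP : cartan D i j <= 0 by apply: cartan_le0.
have bP : cartan D j i <= 0 by apply: cartan_le0; rewrite eq_sym.
have ab := cartan_eq0 D i j.
set p := cartan D i j in aP ab *; set q := cartan D j i in bP ab *.
have [p' pE] : exists n : nat, p = - n%:Z by exists `|p|%N; lia.
have [q' qE] : exists n : nat, q = - n%:Z by exists `|q|%N; lia.
have E (n : nat) : - ((- n%:Z)%:~R) = n%:R :> R by rewrite intrN opprK.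
rewrite pE qE !E; have {}ab : p' = 0%N <-> q' = 0%N.
  case: ab; rewrite pE qE => ab ba; split=> z.
    suff : - (q' : int) = 0 by lia.
    by apply: ab; lia.
  suff : - (p' : int) = 0 by lia.
  by apply: ba; lia.
have [p0|p0] := eqVneq p' 0%N.
  by rewrite (ab.1 p0) p0; constructor 1.
have q0 : q' != 0%N by apply: contraNN p0 => /eqP /ab.2 ->.
have [big|] := leqP 4 (p' * q')%N.
  constructor 4; constructor 4.
  by rewrite !ltr0n -natrM (ler_nat _ 4); split; lia.
case: p' {pE ab} p0 => [|[|[|[|p']]]] //; case: q' {qE} q0 => [|[|[|[|q']]]] // _ _.
all: try by move=> ?; exfalso; lia.
all: move=> _.
- by constructor 2.
- by constructor 3.
- by constructor 4; constructor 2.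
- by constructor 4; constructor 1.
- by constructor 4; constructor 3.
Qed.

(** Both reflections preserve y + span(cor i, cor j), so a word in them is computed on the
    coefficients [p], [q] alone, and a braid relation becomes an identity left to [ring]. *)
Lemma refl_span1 y p q : r i (y - p *: cor i - q *: cor j) =
  y - (al i y - p - q * c j i) *: cor i - q *: cor j.
Proof.
rewrite {1}/refl !evE !ev_coroot cartan_diag.
have -> : al i y - p - q * c j i = p + (al i y - p * 2%:~R - q * c j i) by ring.
rewrite [in RHS]scalerDl opprD !addrA.
by rewrite [LHS]addrAC.
Qed.

Lemma refl_span2 y p q : r j (y - p *: cor i - q *: cor j) =
  y - p *: cor i - (al j y - q - p * c i j) *: cor j.
Proof.
rewrite {1}/refl !evE !ev_coroot cartan_diag.
have -> : al j y - q - p * c i j = q + (al j y - p * c i j - q * 2%:~R) by ring.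
by rewrite [in RHS]scalerDl opprD !addrA.
Qed.

End Dihedral.

(** The third conclusion is the invariant that drives the induction: it keeps the positive
    coordinate large enough to survive the next reflection, and it is preserved exactly because
    [4 <= c i j * c j i]. *)
Lemma dihedral_infinite p i j y : 0 < - c i j -> 0 < - c j i ->
    4 <= c i j * c j i -> 0 < al i y -> 0 < al j y ->
  let z := word_act (alt i j p.+1) y in
  [/\ al i z < 0, 0 < al j z & 0 <= 2 * al i z - c j i * al j z].
Proof.
elim: p i j => [|p IH] i j a0 b0 ab X Y.
  have cX : 0 < - c i j * al i y by rewrite mulr_gt0.
  rewrite /= !ev_refl cartan_diag; split; [lra|lra|].
  have : 0 <= - c j i * al j y by nra.
  have : 0 <= (c i j * c j i - 4) * al i y by nra.
  nra.
have [U V W] := IH j i b0 a0 (etrans (congr1 _ (mulrC _ _)) ab) Y X.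
have -> : word_act (alt i j p.+2) y = r i (word_act (alt j i p.+1) y) by [].
move: (word_act (alt j i p.+1) y) U V W => z U V W z0.
have cV : 0 < - c i j * al i z by rewrite mulr_gt0.
rewrite /z0 !ev_refl cartan_diag; split; [lra|lra|].
have : 0 <= - c j i * (2 * al j z - c i j * al i z) by nra.
have : 0 <= (c i j * c j i - 4) * al i z by nra.
nra.
Qed.

(** Here [m] is the order of r_i r_j. If [m <= p] the braid relation of length [m] is checked on
    coefficients; otherwise [p] is at most 5 and each explicit word is treated by linear
    arithmetic. *)
Ltac finite_dihedral m p Ci Cj T1 T2 E1 E2 E3 E4 span cong ca cb :=
  match type of ca with - ?x = _ => have {}ca : x = Ci by lra end;
  match type of cb with - ?x = _ => have {}cb : x = Cj by lra end;
  have {}T1 := T1 _ cb; have {}T2 := T2 _ ca;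
  have {}E1 := E1 _ ca; have {}E2 := E2 _ cb;
  have [mp|] := leqP m p;
  [ left; exists m; split=> //; apply: span => y /=;
    rewrite !(T1, T2); apply: cong; ring
  | do 6?[case: p => [|p] //]; move=> _; right=> y X Y /=;
    rewrite ?(E1, E2, E3, E4); lra ].

(* The first alternative is a braid relation: longer alternating words are not reduced. *)
Lemma dihedral i j p : i != j ->
  (exists m, [/\ (0 < m)%N, (m <= p)%N & word_act (alt i j m) = word_act (alt j i m)]) \/
  (forall y, 0 < al i y -> 0 < al j y -> 0 < al j (word_act (alt i j p) y)).
Proof.
move=> ij.
have T1 Cj : c j i = Cj -> forall y p q, r i (y - p *: cor i - q *: cor j) =
  y - (al i y - p - q * Cj) *: cor i - q *: cor j.
  by move=> <- *; exact: refl_span1.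
have T2 Ci : c i j = Ci -> forall y p q, r j (y - p *: cor i - q *: cor j) =
  y - p *: cor i - (al j y - q - p * Ci) *: cor j.
  by move=> <- *; exact: refl_span2.
have E1 Ci : c i j = Ci -> forall x, al j (r i x) = al j x - al i x * Ci.
  by move=> <- x; exact: ev_refl.
have E2 Cj : c j i = Cj -> forall x, al i (r j x) = al i x - al j x * Cj.
  by move=> <- x; exact: ev_refl.
have E3 := @ev_refl_same i; have E4 := @ev_refl_same j.
have cong (y : A) t u t' u' : t = t' -> u = u' ->
  y - t *: cor i - u *: cor j = y - t' *: cor i - u' *: cor j by move=> -> ->.
have span m : (forall y, word_act (alt i j m) (y - 0 *: cor i - 0 *: cor j) =
             word_act (alt j i m) (y - 0 *: cor i - 0 *: cor j)) ->
  word_act (alt i j m) = word_act (alt j i m).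
  move=> E; apply/funext => y.
  by have := E y; rewrite !scale0r !subr0.
have [[ca cb]|[ca cb]|[ca cb]|[[ca cb]|[ca cb]|[ca cb]|[ca cb ab]]] := cartan_cases ij.
- finite_dihedral 2%N p (0 : R) (0 : R) T1 T2 E1 E2 E3 E4 span cong ca cb.
- finite_dihedral 3%N p ((-1) : R) ((-1) : R) T1 T2 E1 E2 E3 E4 span cong ca cb.
- finite_dihedral 4%N p ((-1) : R) ((-2) : R) T1 T2 E1 E2 E3 E4 span cong ca cb.
- finite_dihedral 4%N p ((-2) : R) ((-1) : R) T1 T2 E1 E2 E3 E4 span cong ca cb.
- finite_dihedral 6%N p ((-1) : R) ((-3) : R) T1 T2 E1 E2 E3 E4 span cong ca cb.
- finite_dihedral 6%N p ((-3) : R) ((-1) : R) T1 T2 E1 E2 E3 E4 span cong ca cb.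
right=> y X Y; case: p => // p.
have ab' : 4 <= c i j * c j i by rewrite -mulrNN.
by have [] := dihedral_infinite p ca cb ab' X Y.
Qed.

(** * Reduced words and simple transitivity on chambers *)

Definition reduced (s : seq I) := forall s', word_act s' = word_act s -> (size s <= size s')%N.

Lemma reduced_exists s : exists2 s', reduced s' & word_act s' = word_act s.
Proof.
have [n] := ubnP (size s); elim: n s => // n IH s sn.
have [rs|] := pselect (reduced s); first by exists s.
move=> /existsNP[s' /not_implyP[E /negP]]; rewrite -ltnNge => lt.
have [s'' rs'' E''] := IH s' (leq_trans lt sn).
by exists s'' => //; rewrite E''.
Qed.

Local Notation C := (fund_chamber D : set A).

(* Tits: induction through the shortest element of the coset of [s] under the
   subgroup generated by [r i] and [r j], where j is the first letter of [s]. *)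
Lemma reduced_positive s i : reduced s ->
  (exists2 s', (size s' < size s)%N & word_act s' = r i \o word_act s) \/
  (forall x, C x -> 0 < al i (word_act s x)).
Proof.
have [n] := ubnP (size s); elim: n s i => // n IH s i.
case: s => [|j s] sn rs; first by right=> x /(_ i).
have [->|ji] := eqVneq j i.
  by left; exists s => //; apply/funext => x /=; rewrite reflK.
pose dec p := `[< exists a b m, [/\ (a == i) && (b == j) || (a == j) && (b == i),
   word_act (j :: s) = word_act (alt a b p) \o word_act m & size (j :: s) = p + size m]%N >].
have dec1 : dec 1%N.
  by apply/asboolP; exists j, i, s; split=> //; rewrite !eqxx orbT.
have decb p : dec p -> (p <= size (j :: s))%N.
  by move=> /asboolP[a [b [m [_ _ ->]]]]; rewrite leq_addr.
(* Maximality of the alternating prefix is what makes the remainder [m] shortest in its coset. *)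
have [p /asboolP[a [b [m [ab Es sz]]]] pmax] := ex_maxnP (ex_intro (fun p => is_true (dec p)) _ dec1) decb.
have p0 : (0 < p)%N by exact: pmax.
have rm : reduced m.
  move=> m' Em; have := rs (alt a b p ++ m'); rewrite act_cat Em -Es => /(_ erefl).
  by rewrite sz size_cat size_alt leq_add2l.
have mn : (size m < n)%N by move: sn; rewrite ltnS; move: sz; lia.
case: p p0 Es sz pmax => // p _ Es sz pmax.
have [/eqP ai|nai] := boolP (a == i).
  left; exists (alt b a p ++ m); first by rewrite sz size_cat size_alt.
  by rewrite Es act_cat /= ai; apply/funext => x /=; rewrite reflK.
have {ab nai} [aj bi] : a = j /\ b = i.
  by move: ab; rewrite (negPf nai) /= => /andP[/eqP -> /eqP ->].
subst a b.
(* If [r e] shortened [m], the letter [e] could be passed to the prefix: it would either cancel the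
   last letter there, against [rs], or lengthen the prefix, against [pmax]. *)
have pos e : e \in [:: i; j] -> forall x, C x -> 0 < al e (word_act m x).
  move=> ein; have [[m' lt Em]|//] := IH m e mn rm; exfalso.
  have Em' : word_act m = r e \o word_act m' by rewrite Em; apply/funext => x /=; rewrite reflK.
  have [ee|ne] := eqVneq e (if odd p then i else j).
    have /rs : word_act (alt j i p ++ m') = word_act (j :: s).
      rewrite Es Em' act_cat alt_rcons -cats1 act_cat -ee.
      by apply/funext => x /=; rewrite reflK.
    by rewrite sz size_cat size_alt; lia.
  have ee : e = if odd p.+1 then i else j.
    move: ein ne; rewrite !inE /=; case: (odd p) => /=; case/orP => /eqP -> //;
    by rewrite eqxx.
  have Es' : word_act (j :: s) = word_act (alt j i p.+2) \o word_act m'.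
    have -> : alt j i p.+2 = rcons (alt j i p.+1) e by rewrite ee -alt_rcons.
    by rewrite Es Em' -cats1 act_cat.
  have /rs : word_act (alt j i p.+2 ++ m') = word_act (j :: s) by rewrite Es' act_cat.
  rewrite size_cat size_alt sz => le.
  suff /pmax : dec p.+2 by rewrite ltnn.
  apply/asboolP; exists j, i, m'; split=> //; first by rewrite !eqxx orbT.
  by rewrite sz; lia.
have [[q [q0 qp Eq]]|pP] := dihedral p.+1 ji; last first.
  right=> x Cx; rewrite Es /=; apply: (pP (word_act m x)).
  - by apply: pos => //; rewrite !inE eqxx orbT.
  - by apply: pos => //; rewrite !inE eqxx.
(* The braid relation rewrites the prefix so that it begins with [i], and this letter is cancelled
   by [r i]. *)
left; have [a [b Ea]] := alt_cat j i q (p.+1 - q); rewrite subnKC // in Ea.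
case: q q0 qp Eq Ea => // q _ qp Eq Ea.
exists (alt j i q ++ alt a b (p.+1 - q.+1) ++ m).
  by rewrite sz !size_cat !size_alt; lia.
rewrite Es Ea !act_cat Eq; apply/funext => x.
by rewrite -[alt i j q.+1]/(i :: alt j i q) /= reflK.
Qed.

(** If [i :: s] is reduced, then [r i] lengthens [s], so al i is positive on the image of the
    chamber under [s] and negative after the last reflection; hence only the empty word can send a
    point of the chamber into the chamber. *)
Lemma weyl_chamber_simple w x : weyl w -> C x -> C (w x) -> w = id.
Proof.
move=> /weyl_act[s0 <-]; have [[|i s] rs <- //] := reduced_exists s0.
have rs' : reduced s.
  move=> m Em; have := rs (i :: m); rewrite /= Em => /(_ erefl); exact.
move=> Cx Cw; exfalso; have [[s' lt /= E]|pos] := reduced_positive i rs'.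
  by have := rs s' E; rewrite /= leqNgt (leq_trans lt).
have := pos x Cx; have := Cw i; rewrite /= ev_refl_same; lra.
Qed.

End RootDatum.

(** * Roots of the Kac-Moody algebra *)

(** Clearing denominators: multiplied by the product [m] of the denominators, a rational relation
    becomes an integral one. *)
Lemma int_free_rank (I : finType) (d : nat) (N : 'M[int]_(d, #|I|)) :
  (forall v : 'cV[int]_#|I|, N *m v = 0 -> v = 0) ->
  \rank (map_mx intr N : 'M[rat]_(d, #|I|)) = #|I|.
Proof.
move=> free; set Nq := map_mx _ N.
rewrite -mxrank_tr; apply/eqP; rewrite -[_ == _]/(row_free _) -kermx_eq0.
apply/eqP/row_matrixP => k; rewrite row0; set v := row k _.
have vN : v *m Nq^T = 0 by rewrite /v -row_mul mulmx_ker row0.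
clearbody v.
pose m := \prod_j denq (v 0 j).
pose n : 'cV[int]_#|I| :=
  \col_j (numq (v 0 j) * \prod_(l | l != j) denq (v 0 l)).
have nE : map_mx intr n = m%:~R *: v^T :> 'cV[rat]_#|I|.
  apply/colP => j.
  have -> : m = denq (v 0 j) * \prod_(l | l != j) denq (v 0 l) by exact: bigD1.
  rewrite !mxE !intrM -[X in _ = _ * X]divq_num_den.
  by field; rewrite intr_eq0 denq_neq0.
have m0 : m%:~R != 0 :> rat.
  by rewrite intr_eq0; apply/prodf_neq0 => j _; exact: denq_neq0.
have n0 : n = 0.
  apply: free.
  have E : map_mx intr (N *m n) = 0 :> 'cV[rat]_d.
    rewrite map_mxM nE -scalemxAr -[map_mx _ N]trmxK -trmx_mul.
    by rewrite vN trmx0 scaler0.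
  apply/colP => l; apply: (@intr_inj rat).
  by have := congr1 (fun u : 'cV_d => u l 0) E; rewrite !mxE.
apply: trmx_inj; apply: (scalerI m0).
by rewrite -nE n0 trmx0 scaler0 map_mx0.
Qed.

Section RootDatum.
Variables (R : realType) (I : finType) (d : nat) (D : root_datum I d).
Local Notation A := 'rV[R]_d.
Local Notation al j x := (ev x (rootR R D j)).
Local Notation r := (@refl R I d D).

(** Independence over Z passes to Q by clearing denominators and to R because the rank is unchanged
    by field extension. Points with prescribed simple root values all come from here. *)
Lemma simple_root_dual (t : I -> R) : exists x : A, forall i, al i x = t i.
Proof.
pose N : 'M[int]_(d, #|I|) := \matrix_(k, j) simple_root D (enum_val j) k 0.
have rN : \rank (map_mx intr N : 'M[rat]_(d, #|I|)) = #|I|.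
  apply: int_free_rank => v Nv; apply/colP => j; rewrite mxE.
  have := root_free (r := D) (n := fun i => v (enum_rank i) 0) _ (enum_val j).
  rewrite enum_valK; apply; apply/colP => k.
  have := congr1 (fun u : 'cV_d => u k 0) Nv; rewrite /= !mxE => <-.
  rewrite summxE (reindex (enum_val (A := predT))) /=; last first.
    by apply: onW_bij; exact: enum_val_bij.
  by apply: eq_bigr => l _; rewrite !mxE enum_valK mulrC.
have fN : row_full (map_mx intr N : 'M[R]_(d, #|I|)).
  apply/eqP; rewrite -[RHS]rN -(mxrank_map (@ratr R)) -map_mx_comp.
  by congr (\rank _); apply/matrixP => k l; rewrite !mxE /= ratr_int.
have /submxP[x xE] : ((\row_j t (enum_val j)) <= (map_mx intr N : 'M[R]_(d, #|I|)))%MS.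
  exact: submx_full.
exists x => i; have := congr1 (fun u : 'rV_#|I| => u 0 (enum_rank i)) xE.
rewrite /= mxE enum_rankK => ->; rewrite /ev !mxE.
by apply: eq_bigr => l _; rewrite !mxE enum_rankK.
Qed.

(** Analogue of the half-sum of the positive coroots: adding multiples of it goes deeper into the
    sector, at unit speed for every simple root. *)
Definition rho : A := xget 0 [set x | forall i, al i x = 1].

Lemma al_rho i : al i rho = 1.
Proof. by move: i; apply: (@xgetPex _ 0 _ (simple_root_dual (fun=> 1))). Qed.

End RootDatum.

(** * Root strings through the simple roots *)

Section KacMoodyRoots.
Variables (K : fieldType) (I : finType) (C : I -> I -> int).
Hypothesis charK : [pchar K] =i pred0.
Variable L : kac_moody_algebra K C.
Local Notation br := (@km_br K I C L).
Local Notation e := (@km_e K I C L).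
Local Notation f := (@km_f K I C L).
Local Notation inj := (@km_inj K I C L).

Lemma br0l y : br 0 y = 0.
Proof.
have := km_br_linearl (k := L) y 1 0 0; rewrite !scale1r addr0 => /esym/eqP.
by rewrite -subr_eq0 addrK => /eqP.
Qed.

Lemma br0r y : br y 0 = 0.
Proof.
have := km_br_linearr (k := L) y 1 0 0; rewrite !scale1r addr0 => /esym/eqP.
by rewrite -subr_eq0 addrK => /eqP.
Qed.

Lemma brDl y x x' : br (x + x') y = br x y + br x' y.
Proof. by have := km_br_linearl (k := L) y 1 x x'; rewrite !scale1r. Qed.

Lemma brDr y x x' : br y (x + x') = br y x + br y x'.
Proof. by have := km_br_linearr (k := L) y 1 x x'; rewrite !scale1r. Qed.

Lemma brZl a x y : br (a *: x) y = a *: br x y.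
Proof. by have := km_br_linearl (k := L) y a x 0; rewrite br0l !addr0. Qed.

Lemma brZr a x y : br x (a *: y) = a *: br x y.
Proof. by have := km_br_linearr (k := L) x a y 0; rewrite br0r !addr0. Qed.

Lemma brC x y : br x y = - br y x.
Proof.
have := km_brxx (k := L) (x + y); rewrite brDl !brDr !km_brxx add0r addr0.
by move/eqP; rewrite addr_eq0 => /eqP.
Qed.

Lemma brNr x y : br x (- y) = - br x y.
Proof. by rewrite -scaleN1r brZr scaleN1r. Qed.

Lemma brNl x y : br (- x) y = - br x y.
Proof. by rewrite -scaleN1r brZl scaleN1r. Qed.

Lemma ad_bracket x y z : br x (br y z) = br (br x y) z + br y (br x z).
Proof.
have /eqP := km_jacobi (k := L) x y z.
rewrite (brC z (br x y)) (brC z x) brNr -addrA addr_eq0 opprD !opprK.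
by move/eqP ->; rewrite addrC.
Qed.

Lemma coroot_neq0 i : km_coroot L i != 0.
Proof.
by apply: (free_not0 (km_coroot_free L)); apply: map_f; rewrite mem_enum.
Qed.

Lemma natK_neq0 n : (0 < n)%N -> n%:R != 0 :> K.
Proof.
move=> n0; have /pcharf0P -> := charK.
by rewrite -lt0n.
Qed.

Lemma e_neq0 i : e i != 0.
Proof.
apply/eqP => e0; have := km_ef L i i; rewrite eqxx e0 br0l => /esym.
rewrite -(raddf0 inj) => /(km_inj_inj (k := L)) h0.
by have := coroot_neq0 i; rewrite h0 eqxx.
Qed.

Lemma f_neq0 i : f i != 0.
Proof.
apply/eqP => e0; have := km_ef L i i; rewrite eqxx e0 br0r => /esym.
rewrite -(raddf0 inj) => /(km_inj_inj (k := L)) h0.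
by have := coroot_neq0 i; rewrite h0 eqxx.
Qed.

Lemma simple_is_root i : km_is_root L (fun j => (j == i)%:Z).
Proof.
split; first by exists i; rewrite eqxx.
exists (e i); first exact: e_neq0.
move=> h; rewrite km_he (bigD1 i) //= eqxx mul1r big1 ?addr0 // => j /negPf ->.
by rewrite mul0r.
Qed.

Lemma opp_simple_is_root i : km_is_root L (fun j => - (j == i)%:Z).
Proof.
split; first by exists i; rewrite eqxx.
exists (f i); first exact: f_neq0.
move=> h; rewrite km_hf (bigD1 i) //= eqxx rmorphN /= mulN1r big1 ?addr0 //.
by move=> j /negPf ->; rewrite oppr0 mul0r.
Qed.

Definition ad_e i m j := iter m (br (e i)) (e j).

Lemma ad_e_weight i m j h :
  br (inj h) (ad_e i m j) = (m%:R * km_root L i h + km_root L j h) *: ad_e i m j.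
Proof.
elim: m => [|m IH]; first by rewrite mul0r add0r km_he.
rewrite /= -/(ad_e i m j) ad_bracket km_he IH brZl brZr -scalerDl.
by congr (_ *: _); rewrite -natr1; ring.
Qed.

(** Each passage of [f i] across a factor [e i] produces the coroot of [i], whose value on the
    weight of [ad_e i l j] is C i j + 2l; the sum for l from 0 to m is (m + 1)(C i j + m). *)
Lemma f_ad_e i m j : i != j -> C i i = 2 ->
  br (f i) (ad_e i m.+1 j) =
    (- m.+1%:R * ((C i j)%:~R + m%:R)) *: ad_e i m j.
Proof.
move=> ij Cii; elim: m => [|m IH].
  rewrite /= /ad_e /= ad_bracket (brC (f i) (e j)) km_ef eq_sym (negPf ij).
  rewrite oppr0 br0r addr0 brC (brC (f i)) km_ef eqxx brNr opprK.
  rewrite brC km_he km_root_coroot -scaleNr; congr (_ *: _); ring.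
have adS p : br (e i) (ad_e i p j) = ad_e i p.+1 j by [].
rewrite -[ad_e i m.+2 j]adS ad_bracket IH brZr (brC (f i)) km_ef eqxx brNl !adS ad_e_weight.
rewrite !km_root_coroot Cii -scaleNr -scalerDl; congr (_ *: _).
by rewrite -!natr1; ring.
Qed.

(* The coefficient in [f_ad_e] does not vanish below the length of the string. *)
Lemma ad_e_neq0 i j m : i != j -> C i i = 2 -> m%:Z <= - C i j -> ad_e i m j != 0.
Proof.
move=> ij Cii; elim: m => [|m IH] mC; first exact: e_neq0.
apply/eqP => E; have := f_ad_e m ij Cii; rewrite E br0r => /esym/eqP.
rewrite scaler_eq0 (negPf (IH _)) ?orbF; last by lia.
rewrite mulf_eq0 oppr_eq0 (negPf (natK_neq0 _)) //=.
have -> : C i j = - (`|C i j|%N)%:Z by lia.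
rewrite rmorphN /= -pmulrn addrC -[_%:R - _]opprB oppr_eq0 -natrB; last by lia.
by apply/negP; apply: natK_neq0; lia.
Qed.

(** The weight is r_i alpha_j, at the end of the alpha_i-string through alpha_j. With -alpha_i,
    these roots bound the image under r_i of a fundamental sector, which is thereby enclosed. *)
Lemma reflected_simple_is_root i j : i != j -> C i i = 2 -> C i j <= 0 ->
  km_is_root L (fun l => (l == j)%:Z - C i j * (l == i)%:Z).
Proof.
move=> ij Cii Cij; split; first by exists j; rewrite eqxx [j == i]eq_sym (negPf ij) mulr0.
exists (ad_e i `|C i j|%N j); first by apply: ad_e_neq0 => //; lia.
move=> h; rewrite ad_e_weight; congr (_ *: _).
rewrite (bigD1 i) //= (bigD1 j) 1?eq_sym //= big1 ?addr0; last first.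
  by move=> l /andP[/negPf -> /negPf ->]; rewrite mulr0 subr0 mul0r.
have ji : j == i = false by rewrite eq_sym (negPf ij).
rewrite !eqxx ji mulr0 subr0 mul1r mulr1 sub0r.
by congr (_ * _ + _); rewrite pmulrn; congr (_%:~R); lia.
Qed.

End KacMoodyRoots.

(** * Topology of the model apartment *)

Lemma finite_upper_bound (R : realType) (J : finType) (t : J -> R) :
  exists2 N, 0 <= N & forall i, t i <= N.
Proof.
exists (\sum_i `|t i|); first by apply: sumr_ge0.
move=> i; apply: le_trans (ler_norm _) _.
by rewrite (bigD1 i) //= lerDl sumr_ge0.
Qed.

Lemma finite_small_positive (R : realType) (J : finType) (a b : J -> R) :
  (forall i, 0 < a i) ->
  exists2 e, 0 < e & forall t, 0 <= t < e -> forall i, 0 < a i + t * b i.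
Proof.
move=> a0; have [N N0 NP] := finite_upper_bound (fun i => `|b i| / a i).
exists (N + 1)^-1; first by rewrite invr_gt0; lra.
move=> t /andP[t0]; rewrite -div1r ltr_pdivlMr; last by lra.
move=> tN i; have := NP i; rewrite ler_pdivrMr // => bN.
have h1 : - b i <= N * a i by apply: le_trans bN; rewrite -normrN ler_norm.
have h2 : t * (- b i) <= t * (N * a i) by rewrite ler_wpM2l.
have h3 : 0 < (1 - t * (N + 1)) * a i by rewrite mulr_gt0 // subr_gt0.
have h4 : 0 <= t * a i by rewrite mulr_ge0 // ltW.
lra.
Qed.

Section VectorTopology.
Variables (R : realType) (d : nat).
Local Notation A := 'rV[R]_d.

Lemma nbhs_rV (x : A) (O : set A) : nbhs x O <->
  exists2 e : R, 0 < e & forall y : A, (forall j, `|x 0 j - y 0 j| < e) -> O y.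
Proof.
split=> [/(nbhs_ballP x)[e /= e0 eO]|[e e0 eO]].
  exists e => // y xy; apply: eO; split=> // i j; rewrite (ord1 i).
  exact: xy.
apply/(nbhs_ballP x); exists e => // y [_ xy]; apply: eO => j; exact: xy.
Qed.

Lemma ev_sum (x : A) b : ev x b = \sum_j x 0 j * b j 0.
Proof. by rewrite /ev mxE. Qed.

Lemma ev_near (J : finType) (b : J -> 'cV[R]_d) (x : A) (e : R) : 0 < e ->
  nbhs x [set y : A | forall i, `|ev y (b i) - ev x (b i)| < e].
Proof.
move=> e0.
have [N N0 NP] := finite_upper_bound (fun i : J => \sum_j `|b i j 0|).
apply/nbhs_rV; exists (e / (N + 1)); first by rewrite divr_gt0 //; lra.
move=> y xy i; rewrite -evB ev_sum.
apply: le_lt_trans (ler_norm_sum _ _ _) _.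
have h : \sum_j `|(y - x) 0 j * b i j 0| <= \sum_j (e / (N + 1)) * `|b i j 0|.
  apply: ler_sum => j _; rewrite normrM ler_wpM2r // !mxE distrC.
  exact/ltW/xy.
apply: le_lt_trans h _; rewrite -mulr_sumr.
apply: (@le_lt_trans _ _ (e / (N + 1) * N)).
  by rewrite ler_wpM2l // divr_ge0 //; lra.
by rewrite mulrAC ltr_pdivrMr; [rewrite ltr_pM2l //; lra|lra].
Qed.

Lemma line_near (b v : A) (O : set A) : nbhs b O ->
  exists2 e, 0 < e & forall t, `|t| < e -> O (b + t *: v).
Proof.
move=> /nbhs_rV[e e0 eO].
have [N N0 NP] := finite_upper_bound (fun j => `|v 0 j|).
exists (e / (N + 1)); first by rewrite divr_gt0 //; lra.
move=> t te; apply: eO => j; rewrite !mxE opprD addNKr normrN normrM.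
apply: (@le_lt_trans _ _ (`|t| * N)); first by rewrite ler_wpM2l.
move: te; rewrite ltr_pdivlMr; last by lra.
apply: le_lt_trans; rewrite ler_wpM2l //; lra.
Qed.

Lemma closure_ev_ge0 (V : set A) b u : closure V u ->
  (forall v, V v -> 0 <= ev v b) -> 0 <= ev u b.
Proof.
move=> cu V0; rewrite leNgt; apply/negP => u0.
have e0 : 0 < - ev u b by rewrite oppr_gt0.
have [v [/V0 v0 /(_ tt)]] := cu _ (ev_near (fun _ : unit => b) u e0).
rewrite ltr_norml; lra.
Qed.

Lemma closure_ray (V : set A) (u v : A) :
  (forall t, 0 < t -> V (u + t *: v)) -> closure V u.
Proof.
move=> uV O /line_near - /(_ v)[e e0 eO].
exists (u + (e / 2) *: v); split; first by apply: uV; lra.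
by apply: eO; rewrite ger0_norm; lra.
Qed.

Lemma ler_coord_norm (x : A) j : `|x 0 j| <= `|x|.
Proof.
rewrite [leRHS]/Num.norm /= mx_normrE.
by apply/bigmax_geP; right; exists (0, j).
Qed.

(* The coordinates bound N from above, and N is bounded below on the unit sphere. *)
Lemma norm_bound (N : A -> R) (b : 'cV[R]_d) : is_norm N ->
  exists2 K, 0 < K & forall x, `|ev x b| <= K * N x.
Proof.
move=> [ND NZ N0].
have N00 : N 0 = 0 by rewrite -(scale0r 0) NZ normr0 mul0r.
have Nge0 x : 0 <= N x.
  have := ND x (- x); rewrite subrr N00 -scaleN1r NZ normrN1 mul1r; lra.
pose S := \sum_j N (delta_mx 0 j).
have Nsum (x : A) t : (forall j, `|x 0 j| <= t) -> N x <= t * S.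
  move=> xt; rewrite {1}(row_sum_delta x).
  apply: (@le_trans _ _ (\sum_j N (x 0 j *: delta_mx 0 j))).
    elim/big_ind2: _ => [||//]; first by rewrite N00.
    by move=> x1 x2 y1 y2 h1 h2; apply: le_trans (ND _ _) _; exact: lerD.
  by rewrite /S mulr_sumr; apply: ler_sum => j _; rewrite NZ ler_wpM2r.
have S0 : 0 <= S by apply: sumr_ge0.
have Ncont : continuous N.
  move=> x B /(nbhs_ballP (N x))[e /= e0 eB].
  apply/nbhs_rV; exists (e / (S + 1)); first by rewrite divr_gt0 //; lra.
  move=> y xy; apply: eB; rewrite /ball /=.
  have h z w : N z - N w <= N (z - w).
    by have := ND (z - w) w; rewrite subrK; lra.
  have hyx : N (y - x) = N (x - y).
    by rewrite -opprB -scaleN1r NZ normrN1 mul1r.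
  apply: (@le_lt_trans _ _ (N (x - y))).
    by rewrite ler_norml; have := h x y; have := h y x; rewrite hyx; lra.
  apply: le_lt_trans (Nsum _ (e / (S + 1)) _) _.
    by move=> j; rewrite !mxE; exact/ltW.
  by rewrite mulrAC ltr_pdivrMr; [rewrite ltr_pM2l //; lra|lra].
pose Sph := [set x : A | `|x| = 1].
have [b' b'0 b'P] : exists2 K, 0 < K & forall x, `|ev x b| <= K * `|x|.
  exists (1 + \sum_j `|b j 0|); first by rewrite ltr_pwDl // sumr_ge0.
  move=> x; rewrite ev_sum; apply: le_trans (ler_norm_sum _ _ _) _.
  rewrite mulrDl mul1r mulr_suml; apply: le_trans (_ : \sum_j `|b j 0| * `|x| <= _).
    apply: ler_sum => j _; rewrite normrM mulrC ler_wpM2l //.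
    exact: ler_coord_norm.
  by rewrite lerDr.
(* The sphere is empty only in dimension 0, where every vector vanishes. *)
have [[x0 x0S]|noS] := pselect (Sph !=set0); last first.
  exists 1 => // x; have [->|xn0] := eqVneq x 0; first by rewrite ev0 normr0 N00 mulr0.
  exfalso; apply: noS; exists (`|x|^-1 *: x).
  by rewrite /Sph /= normrZ normfV normr_id mulVf // normr_eq0.
have Scompact : compact Sph.
  apply: bounded_closed_compact.
    by exists 1; split=> // M M1 x /= ->; exact: ltW.
  have -> : Sph = (fun x : A => `|x|) @^-1` [set 1] by [].
  apply: closed_comp; first by move=> x _; exact: norm_continuous.
  exact: closed_eq.
have [m /set_mem mS mmin] := EVT_min_rV (ex_intro _ x0 x0S) Scompact
  (continuous_subspaceT Ncont).
have m0 : 0 < N m.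
  rewrite lt_neqAle Nge0 andbT eq_sym; apply/eqP => /N0 mz.
  by move: mS; rewrite /Sph /= mz normr0 => /esym/eqP; rewrite oner_eq0.
exists (b' / N m); first by rewrite divr_gt0.
move=> x; have [->|xn0] := eqVneq x 0; first by rewrite ev0 normr0 N00 mulr0.
have nx : 0 < `|x| by rewrite normr_gt0.
apply: le_trans (b'P x) _; rewrite -mulrA; apply: ler_wpM2l; first exact: ltW.
rewrite [leRHS]mulrC ler_pdivlMr //.
have /mmin : (`|x|^-1 *: x) \in Sph.
  by apply/mem_set; rewrite /Sph /= normrZ normfV normr_id mulVf // gt_eqF.
by rewrite NZ normfV normr_id [leRHS]mulrC ler_pdivlMr // mulrC.
Qed.

End VectorTopology.

(* Cousin's lemma *)
Lemma local_to_global (R : realType) (Q : R -> R -> Prop) :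
  (forall a b c, a <= b -> b <= c -> Q a b -> Q b c -> Q a c) ->
  (forall t, exists2 e, 0 < e & forall s, 0 <= s < e -> Q (t - s) t /\ Q t (t + s)) ->
  forall a b, a <= b -> Q a b.
Proof.
move=> Qtr Qloc a b ab.
pose S := [set t | t <= b /\ Q a t].
have Sa : S a.
  split=> //; have [e e0 /(_ 0)] := Qloc a.
  by rewrite lexx e0 addr0 => /(_ isT)[].
have Sge t : a <= t -> t <= b -> Q a t -> t <= sup S.
  by move=> ? tb Qt; apply: ub_le_sup; [exists b => ? []|split].
have supb : sup S <= b by apply: ge_sup; [exists a|move=> ? []].
have asup : a <= sup S by apply: Sge => //; case: Sa.
have [e e0 loc] := Qloc (sup S).
have Qsup : Q a (sup S).
  have [t [[tb Qt] lt]] : exists t, S t /\ sup S - e < t.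
    have hs : has_sup S by split; [exists a|exists b => ? []].
    by have [t St lt] := sup_adherent e0 hs; exists t.
  have ts : t <= sup S by apply: ub_le_sup; [exists b => ? []|split].
  (* [S] does not demand [a <= t]; for [t] below [a], the interval given by the gauge at the
     supremum already reaches back to [a]. *)
  have [at_|ta] := leP a t; last first.
    have [] := loc (sup S - a); first by apply/andP; split; lra.
    by rewrite subKr.
  apply: (Qtr a t (sup S)) => //; have [] := loc (sup S - t); first by apply/andP; split; lra.
  by rewrite subKr.
have [sb|bs] := ltP (sup S) b; last by rewrite (@le_anti _ _ b (sup S)) ?bs ?supb.
pose s := Num.min (e / 2) (b - sup S).
have s0 : 0 < s by rewrite lt_min; apply/andP; split; lra.
have se : s <= e / 2 by rewrite ge_min lexx.
have sbb : s <= b - sup S by rewrite ge_min lexx orbT.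
clearbody s.
have [_ Qs] : Q (sup S - s) (sup S) /\ Q (sup S) (sup S + s).
  by apply: loc; apply/andP; split; lra.
have : sup S + s <= sup S by apply: Sge; [lra|lra|apply: (Qtr a (sup S) _) => //; lra].
lra.
Qed.

(** * Vectorial faces *)

Section Cones.
Variables (R : realType) (I : finType) (d : nat) (D : root_datum I d).
Local Notation A := 'rV[R]_d.
Local Notation al j x := (ev x (rootR R D j)).
Local Notation r := (@refl R I d D).
Local Notation weyl := (@weyl R I d D).
Local Notation weyl_id := (@weyl_id R I d D).
Local Notation c i j := ((cartan D i j)%:~R : R).
Local Notation C := (fund_chamber D : set A).
Local Notation rho := (rho R D).

Definition dominant (u : A) := forall j, 0 <= al j u.

Lemma closure_chamber u : closure C u <-> dominant u.
Proof.
split=> [cu j|u0].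
  by apply: (closure_ev_ge0 cu) => v Cv; exact/ltW/Cv.
apply: (closure_ray (v := rho)) => t t0 j.
by rewrite !evE al_rho mulr1 ltr_wpDl.
Qed.

Lemma dominantD u v : dominant u -> dominant v -> dominant (u + v).
Proof. by move=> u0 v0 j; rewrite evD addr_ge0. Qed.

Lemma dominantZ t u : 0 <= t -> dominant u -> dominant (t *: u).
Proof. by move=> t0 u0 j; rewrite evZ mulr_ge0. Qed.

Lemma dominant0 : dominant 0.
Proof. by move=> j; rewrite ev0. Qed.

Lemma rho_chamber : C rho.
Proof. by move=> j; rewrite al_rho. Qed.

Lemma closure_face (J : {set I}) u : closure (fund_face D J) u ->
  forall j, if j \in J then al j u = 0 else 0 <= al j u.
Proof.
move=> cu j; case: ifP => jJ; last first.
  by apply: (closure_ev_ge0 cu) => v /(_ j); rewrite jJ; exact: ltW.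
apply: le_anti; apply/andP; split; last first.
  by apply: (closure_ev_ge0 cu) => v /(_ j); rewrite jJ => ->.
rewrite -oppr_ge0 -evNr.
by apply: (closure_ev_ge0 cu) => v /(_ j); rewrite jJ evNr => ->; rewrite oppr0.
Qed.

(** A closed condition is turned into an open one: the test point rho + (e / 2) w^-1 rho is still in
    the chamber, and its image w rho + (e / 2) rho is dominant plus a positive multiple of rho,
    hence in the open chamber. *)
Lemma weyl_id_of_dominant w : weyl w -> (forall p, C p -> dominant (w p)) -> w = id.
Proof.
move=> W wC; have [w' [W' K K']] := weyl_inv W.
have [e e0 eP] := finite_small_positive (fun j => al j (w' rho)) rho_chamber.
have Cp : C (rho + (e / 2) *: w' rho).
  by move=> j; rewrite !evE; apply: eP; apply/andP; split; lra.
apply: (weyl_chamber_simple W Cp) => j.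
rewrite (weylD W) (weylZ W) K' !evE al_rho mulr1.
by have := wC _ rho_chamber j; lra.
Qed.

Definition face_point (J : {set I}) : A :=
  xget 0 [set x | forall j, al j x = if j \in J then 0 else 1].

Lemma al_face_point J j : al j (face_point J) = if j \in J then 0 else 1.
Proof.
have : exists x : A, forall j, al j x = if j \in J then 0 else 1.
  exact: (simple_root_dual D (fun j => if j \in J then 0 else 1)).
by move=> /(@xgetPex _ (0 : A) [set x | forall j, al j x = _]) /(_ j).
Qed.

Lemma face_point_face J t : 0 < t -> fund_face D J (t *: face_point J).
Proof.
by move=> t0 j; rewrite evZ al_face_point; case: (j \in J); rewrite ?mulr0 ?mulr1.
Qed.

Lemma refl_neq_id i : r i <> id.
Proof.
move=> E; have := al_rho R D i; have := ev_refl_same D i rho.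
rewrite E al_rho; lra.
Qed.

(* Near a point of the open panel of i, the chambers are C and [r i C]. *)
Lemma weyl_fix_panel i w : weyl w -> w (face_point [set i]) = face_point [set i] ->
  w = id \/ w = r i.
Proof.
move=> W wp; set p := face_point _ in wp.
have ap j : al j p = if j == i then 0 else 1 by rewrite al_face_point inE.
pose q s := if s then w rho else r i (w rho).
have [e e0 eP] := finite_small_positive
  (fun k : I * bool => al k.1 (q k.2)) (fun k : I * bool => ltr01 : 0 < (1 : R)).
have [e' e'0 e'P] := finite_small_positive (fun k : I => al k rho)
  (fun k : I => ltr01 : 0 < (1 : R)).
pose t := e / 2.
have t0 : 0 < t by rewrite /t; lra.
have te s : forall j, j != i -> 0 < al j (p + t *: q s).
  move=> j ji; rewrite !evE ap (negPf ji).
  by apply: (eP t _ (j, s)); rewrite /t; apply/andP; split; lra.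
have Cx : C (p + t *: rho).
  by move=> j; rewrite !evE ap al_rho mulr1; case: eqP => _; lra.
have rp : r i p = p by rewrite /refl ap eqxx scale0r subr0.
have wx : w (p + t *: rho) = p + t *: q true by rewrite (weylD W) (weylZ W) wp.
have rwx : r i (w (p + t *: rho)) = p + t *: q false.
  by rewrite wx reflD reflZ rp.
have aip s : al i (p + t *: q s) = t * al i (q s) by rewrite !evE ap eqxx add0r.
have [neg|pos|zer] := ltgtP (al i (w rho)) 0.
- right.
  have Cr : C ((r i \o w) (p + t *: rho)).
    move=> j; rewrite [_ (p + _)]rwx; have [->|ji] := eqVneq j i; last exact: te.
    by rewrite aip /= ev_refl_same mulr_gt0 // oppr_gt0.
  have /(congr1 (fun h => r i \o h)) E := weyl_chamber_simple (weyl_refl i W) Cx Cr.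
  by apply/funext => x; have := congr1 (fun h => h x) E; rewrite /= reflK.
- left; apply: (weyl_chamber_simple W Cx) => j; rewrite wx.
  by have [->|ji] := eqVneq j i; [rewrite aip mulr_gt0|exact: te].
(* If [w rho] lay on the wall of [i], then [w' \o (r i \o w)] would fix a point of the chamber,
   hence be the identity, and so would [r i]. *)
exfalso; have [w' [W' K K']] := weyl_inv W.
have fixx : (w' \o (r i \o w)) (p + t *: rho) = p + t *: rho.
  by rewrite /= rwx /= /refl zer scale0r subr0 -[w rho]/(q true) -wx K.
have /(weyl_chamber_simple (weyl_comp W' (weyl_refl i W)) Cx) : C
    ((w' \o (r i \o w)) (p + t *: rho)) by rewrite fixx.
move=> E; apply: (@refl_neq_id i); apply/funext => x.
by have := congr1 (fun h => w (h (w' x))) E; rewrite /= !K'.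
Qed.

Lemma large_sector (x : A) (n : R) : exists t, forall s, t <= s ->
  forall j, n <= al j (x + s *: rho).
Proof.
have [N N0 NP] := finite_upper_bound (fun j => - al j x).
exists (`|n| + N) => s ts j; rewrite !evE al_rho mulr1.
by have := NP j; have := ler_norm n; lra.
Qed.

Lemma fund_face0 : fund_face D finset.set0 = C.
Proof.
apply/seteqP; split=> x /= xP j; have := xP j; by rewrite ?inE.
Qed.

Lemma vect_face_fund J : vect_face D true (fund_face D J : set A).
Proof.
exists id, J; split; first exact: weyl_id.
by apply/seteqP; split=> x; [move=> Fx; exists x; rewrite /sgn ?scale1r|
  case=> y Fy <-; rewrite /sgn scale1r].
Qed.

Lemma spherical_fund_chamber : spherical D (fund_face D finset.set0 : set A).
Proof.
exists rho; split; first by rewrite fund_face0; exact: rho_chamber.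
left; have := ev_near (fun j => rootR R D j) rho (ltr01 : 0 < (1:R)).
apply: filterS => y yP; exists id, y; split=> //; first exact: weyl_id.
apply/closure_chamber => j; have := yP j; rewrite al_rho ltr_norml; lra.
Qed.

(** The closures of C and r_i C together fill a neighbourhood of a point of the open panel, so the
    panel meets the interior of the Tits cone. *)
Lemma spherical_panel i : spherical D (fund_face D [set i] : set A).
Proof.
set p : A := face_point [set i].
have ap j : al j p = if j == i then 0 else 1 by rewrite al_face_point inE.
exists p; split; first by rewrite -[p]scale1r; exact: face_point_face.
left.
have rP j y : ev y (rootR R D j - c i j *: rootR R D i) = al j (r i y).
  by rewrite ev_refl evDr evNr evZr mulrC.
have rp : r i p = p by rewrite /refl ap eqxx scale0r subr0.
have := ev_near (fun k : I * bool =>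
   if k.2 then rootR R D k.1 else rootR R D k.1 - c i k.1 *: rootR R D i) p
  (ltr01 : 0 < (1:R)).
apply: filterS => y yP.
have [y0|y0] := leP 0 (al i y).
  exists id, y; split=> //; first exact: weyl_id.
  apply/closure_chamber => j; have := yP (j, true); rewrite /= ap ltr_norml.
  by case: eqP => [->//|_]; lra.
exists (r i), (r i y); split; [exact: weyl_refl1| |by rewrite reflK].
apply/closure_chamber => j; have := yP (j, false); rewrite /= !rP rp ap ltr_norml.
by case: eqP => [->|_]; [rewrite ev_refl_same|]; lra.
Qed.

End Cones.

(** * Enclosures and chimney germs *)

Section Enclosures.
Variables (R : realType) (I : finType) (d : nat) (D : root_datum I d).
Variable L : kac_moody_algebra R[i] (cartan D).
Local Notation A := 'rV[R]_d.
Local Notation al j x := (ev x (rootR R D j)).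
Local Notation r := (@refl R I d D).
Local Notation c i j := ((cartan D i j)%:~R : R).
Local Notation rho := (rho R D).
Local Notation face_point J := (face_point R D J).
Local Notation fund_face J := (fund_face D J : set A).

Lemma all_roots_comb a : all_roots L a ->
  exists n : I -> int, forall x, ev x a = \sum_i (n i)%:~R * al i x.
Proof.
case=> n _ <-; exists n => x; rewrite /ev mulmx_sumr summxE.
by apply: eq_bigr => i _; rewrite -scaler_int -scalemxAr mxE.
Qed.

Lemma pchar_complex : [pchar R[i]] =i pred0.
Proof. exact: pchar_num. Qed.

Lemma sum_root_delta (b : I -> 'cV[R]_d) i :
  \sum_j b j *~ (j == i)%:Z = b i.
Proof.
by rewrite (bigD1 i) //= eqxx big1 ?addr0 // => j /negPf ->.
Qed.

Lemma all_roots_simple i : all_roots L (rootR R D i).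
Proof.
exists (fun j => (j == i)%:Z); first exact: (simple_is_root L).
exact: sum_root_delta.
Qed.

Lemma all_roots_refl i j : all_roots L (rootR R D j - c i j *: rootR R D i).
Proof.
have [->|ij] := eqVneq j i.
  exists (fun j => - (j == i)%:Z); first exact: (opp_simple_is_root L).
  under eq_bigr do rewrite mulrNz.
  rewrite sumrN sum_root_delta cartan_diag -{2}[rootR R D i]scale1r -scalerBl.
  by rewrite -scaleN1r; congr (_ *: _); lra.
have ji : i != j by rewrite eq_sym.
exists (fun l => (l == j)%:Z - cartan D i j * (l == i)%:Z).
  by apply: (reflected_simple_is_root pchar_complex L ji (cartan_diag _ _));
     exact: cartan_le0.
rewrite (bigD1 j) //= (bigD1 i) //= big1 ?addr0; last first.
  by move=> l /andP[/negPf -> /negPf ->]; rewrite mulr0.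
by rewrite !eqxx (negPf ji) eq_sym (negPf ji) mulr0 subr0 mulr1 sub0r mulrNz scaler_int.
Qed.

Lemma ev_refl_root i j (x : A) :
  ev x (rootR R D j - c i j *: rootR R D i) = al j (r i x).
Proof. by rewrite ev_refl evDr evNr evZr mulrC. Qed.

Definition enclosed (P : set A) :=
  exists k, P = \bigcap_(a in all_roots L) closed_half a (k a).

(** Intersections of closed half-spaces are closed. This adds the origin of a segment to what is
    known on the open segment. *)
Lemma enclosed_limit P b v e : enclosed P -> 0 < e ->
  (forall t, 0 < t < e -> P (b + t *: v)) -> P b.
Proof.
move=> [k ->] e0 bP a aR; rewrite /closed_half /=.
case ka: (k a) => [m|//]; rewrite leNgt; apply/negP => neg.
have pos (i : unit) : 0 < - (ev b a + m%:~R) by lra.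
have [e' e'0 e'P] := finite_small_positive (fun=> - ev v a) pos.
pose t := Num.min (e' / 2) (e / 2).
have tP s : 0 <= s < e' -> 0 < - (ev b a + m%:~R) + s * - ev v a.
  by move=> /e'P/(_ tt).
clear pos e'P.
have t0 : 0 < t by rewrite lt_min; apply/andP; split; lra.
have te : t <= e / 2 by rewrite ge_min lexx orbT.
have te' : t <= e' / 2 by rewrite ge_min lexx.
clearbody t.
have t_e : 0 < t < e by apply/andP; split; lra.
have t_e' : 0 <= t < e' by apply/andP; split; lra.
have := bP t t_e a aR; rewrite /closed_half /= ka !evE.
have := tP t t_e'; lra.
Qed.

(** Enclosures only admit integral thresholds, whence the roundings by [Num.ceil] where this is
    applied. *)
Lemma enclosed_ge (b : I -> 'cV[R]_d) (m : int) : (forall j, all_roots L (b j)) ->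
  enclosed [set x | forall j, m%:~R <= ev x (b j)].
Proof.
move=> bR; exists (fun a => if pselect (exists j, a = b j) then Some (- m) else None).
apply/seteqP; split=> x /= xP.
  move=> a _; rewrite /closed_half /=; case: pselect => // -[j aj] /=.
  by rewrite aj rmorphN subr_ge0.
move=> j; have := xP (b j) (bR j); rewrite /closed_half /=.
by case: pselect => [h|[]] /=; [rewrite rmorphN subr_ge0|exists j].
Qed.

(** A root that effectively bounds [P] is nonnegative on dominant vectors, for otherwise a ray of
    direction [u] inside the deep sector would leave [P]. *)
Lemma enclosed_sector_add P a u (n : R) : enclosed P -> P a ->
  (forall x, (forall j, n <= al j x) -> P x) -> dominant D u -> P (a + u).
Proof.
move=> [k ->] Pa nP u0 b bR.
have := Pa b bR; rewrite /closed_half /=; case kb: (k b) => [m|//].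
rewrite evD; suff : 0 <= ev u b by lra.
rewrite leNgt; apply/negP => neg.
have [t tP] := large_sector D 0 n.
pose x : A := t *: rho.
have xP s : 0 <= s -> 0 <= ev x b + s * ev u b + m%:~R.
  move=> s0; have /nP/(_ b bR) : forall j, n <= al j (x + s *: u).
    move=> j; have := tP t (lexx _) j; rewrite add0r !evE.
    have : 0 <= s * al j u by apply: mulr_ge0 => //; exact: u0.
    lra.
  by rewrite /closed_half /= kb !evE.
pose y := ev x b + m%:~R.
have y0 : 0 <= y by have := xP 0 (lexx _); rewrite mul0r addr0.
(* At this time the affine function, equal to [y] at the start of the ray, takes the value -1. *)
have : 0 <= (y + 1) / - ev u b by rewrite divr_ge0 // ?oppr_ge0; lra.
move=> /xP; rewrite invrN mulrN mulNr mulfVK ?lt_eqF // /y; lra.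
Qed.

(* Up to shrinking, the sets [a + u + F^v(J)] with u in the closure of [F^v(J)]. *)
Definition far_face (J : {set I}) (a : A) (n : R) : set A :=
  [set x | forall j, if j \in J then al j x = al j a else n <= al j x].

Definition far_face_germ (J : {set I}) (a : A) : set_system A :=
  [set E | exists2 P, enclosed P /\ P `<=` E & exists n, far_face J a n `<=` P].

Lemma fund_faceT_ev v a : all_roots L a -> fund_face [set: I]%SET v -> ev v a = 0.
Proof.
move=> /all_roots_comb[n ->] v0; rewrite big1 // => i _.
by have := v0 i; rewrite inE => ->; rewrite mulr0.
Qed.

(** The axioms deal with faces, so a point [a] is replaced by its smallest face, of direction
    F^v(I). All roots vanish on F^v(I), so [P] contains a + F^v(I) as soon as it contains [a]. *)
Lemma face_enclosed P a : enclosed P -> P a -> face L a (fund_face [set: I]%SET) P.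
Proof.
move=> [k ->] Pa; exists k, (fun=> None), setT; split.
- exact: filterT.
- by move=> x xP b bR; have [] := xP b bR.
move=> _ [_ [v v0 <-]] b bR; split=> //.
have := Pa b bR; rewrite /closed_half /=; case: (k b) => // m.
by rewrite evD (fund_faceT_ev bR v0) addr0.
Qed.

Lemma chimney_germ_elim a W V E : chimney_germ L (face L a W) V E ->
  exists P, [/\ enclosed P, P `<=` E & exists O u, [/\ nbhs a O, closure V u &
    forall x v, O x -> W (x - a) -> V v -> P (x + u + v)]].
Proof.
case=> u cu [k [E1 [E0 [k1 [k2 [U [nO kE kO]]]] E01] E1P] PE].
exists (\bigcap_(a in all_roots L) closed_half a (k a)); split=> //; first by exists k.
exists U, u; split=> // x v Ox Wx Vv; apply: E1P; exists (x + u); last by exists v.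
apply: E01; exists x; last by exists u.
apply/kE/kO; split=> //; exists (x - a) => //.
by rewrite addrC subrK.
Qed.

Lemma fund_face0T : fund_face [set: I]%SET 0.
Proof. by move=> j; rewrite inE ev0. Qed.

(** Trades the nested filters of a chimney germ for bounds on simple roots. In the harder inclusion,
    a root bounding [P] has nonnegative coefficients outside [J]; a long shift along F^v(J) then
    makes up for the gap between [a] and a point [x0] of the far face. *)
Lemma far_face_germE J a :
  chimney_germ L (face L a (fund_face [set: I]%SET)) (fund_face J) =
  far_face_germ J a.
Proof.
apply/seteqP; split=> E.
  move=> /chimney_germ_elim[P [eP PE [U [u [nO cu OP]]]]].
  exists P => //; have [N N0 NP] := finite_upper_bound (fun j => al j (a + u)).
  exists (N + 1) => x xP.
  have -> : x = a + u + (x - (a + u)) by rewrite addrC subrK.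
  apply: OP; [exact: nbhs_singleton| by rewrite subrr; exact: fund_face0T|].
  move=> j; have := xP j; have := NP j; have := closure_face cu j.
  rewrite !evE; case: ifP => _ // uj; lra.
case=> P [[k PE] PsubE] [n nP].
(* The smallest enclosed set containing [a]; the integral thresholds impose the floors, each losing
   less than 1. *)
pose E0 := \bigcap_(b in all_roots L) closed_half b (Some (- Num.floor (ev a b))).
have E0P e b : E0 e -> all_roots L b -> (Num.floor (ev a b))%:~R <= ev e b.
  by move=> E0e bR; have := E0e b bR; rewrite /closed_half /= rmorphN subr_ge0.
have E0a : E0 a.
  by move=> b bR; rewrite /closed_half /= rmorphN subr_ge0 ge_floor.
have [x0 x0E] := simple_root_dual D
  (fun j => if j \in J then al j a else Num.max n (al j a)).
(* The added 1 pays for the floors in [E0]. *)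
have [N N0 NP] := finite_upper_bound (fun j => al j x0 - al j a + 1).
have q0 j : 0 <= al j x0 - al j a.
  by rewrite x0E; case: ifP; rewrite ?subrr // subr_ge0 le_max lexx orbT.
have x0P : P x0.
  by apply: nP => j; rewrite x0E; case: (j \in J) => //; rewrite le_max lexx.
have N1 : 0 < N + 1 by lra.
exists ((N + 1) *: face_point J).
  exact/subset_closure/face_point_face.
exists k; last by rewrite -PE.
rewrite -PE; exists [set e + (N + 1) *: face_point J | e in E0].
  exists E0; first by apply: face_enclosed => //; eexists.
  by move=> _ [e Ee [_ -> <-]]; exists e.
move=> _ [_ [e Ee <-]] [v Vv <-]; rewrite PE => b bR.
have := x0P; rewrite PE => /(_ b bR); rewrite /closed_half /=.
case kb : (k b) => [m|//] x0m.
have [nb nbE] := all_roots_comb bR.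
(* With a negative coefficient at [j], moving [x0] along the dual vector [y] would leave [P] while
   staying in the far face. *)
have nb0 j : j \notin J -> 0 <= nb j.
  move=> jJ; rewrite leNgt; apply/negP => neg.
  have [y yE] := simple_root_dual D (fun l => (l == j)%:R : R).
  have evy : ev y b = (nb j)%:~R.
    rewrite nbE (bigD1 j) //= yE eqxx mulr1 big1 ?addr0 // => l /negPf lj.
    by rewrite yE lj mulr0.
  have /nP : far_face J a n (x0 + (ev x0 b + m%:~R + 1) *: y).
    move=> l; rewrite !evE x0E yE; case: eqVneq => [->|_].
      rewrite (negPf jJ) mulr1; have : n <= Num.max n (al j a) by rewrite le_max lexx.
      lra.
    by rewrite mulr0 addr0; case: (l \in J) => //; rewrite le_max lexx.
  rewrite PE => /(_ b bR); rewrite /closed_half /= kb !evE evy.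
  have : (nb j)%:~R <= -1 :> R by rewrite -(rmorphN1 intr) ler_int; lia.
  nra.
have v0 : 0 <= ev v b.
  rewrite nbE; apply: sumr_ge0 => j _; have := Vv j; case: ifP => jJ.
    by move=> ->; rewrite mulr0.
  by move=> vj; rewrite mulr_ge0 ?ler0z ?nb0 ?jJ // ltW.
rewrite !evD evZ; have Eeb := E0P _ _ Ee bR.
have [[j0 j0J nj0]|noj] := pselect (exists2 j0, j0 \notin J & nb j0 != 0).
  have ub : ev x0 b - ev a b + 1 <= (N + 1) * ev (face_point J) b.
    rewrite !nbE mulr_sumr -sumrB (bigD1 j0) //= [leRHS](bigD1 j0) //=.
    rewrite addrAC lerD //.
      rewrite -mulrBr al_face_point (negPf j0J) mulr1.
      have n1 : 1 <= (nb j0)%:~R :> R.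
        by rewrite (ler_int _ 1); have := nb0 _ j0J; lia.
      have := NP j0; nra.
    apply: ler_sum => j _; rewrite -mulrBr mulrCA al_face_point; case: ifP => jJ.
      by rewrite x0E jJ subrr !mulr0.
    rewrite mulr1 ler_wpM2l ?ler0z ?nb0 ?jJ //; have := NP j; lra.
  have /andP[_] := floor_itv (ev a b); rewrite intrD; lra.
(* Now [b] involves only roots of [J] and the shift has no effect on it, but it agrees at [x0] and
   [a], and integrality of [m] makes the floor harmless. *)
have noJ j : j \notin J -> nb j = 0.
  by move=> jJ; apply/eqP; apply: contra_notT noj => ?; exists j.
have -> : ev (face_point J) b = 0.
  rewrite nbE big1 // => j _; rewrite al_face_point; case: ifP => jJ.
    by rewrite mulr0.
  by rewrite noJ ?jJ // mul0r.
have eqx0 : ev x0 b = ev a b.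
  rewrite !nbE; apply: eq_bigr => j _; rewrite x0E; case: ifP => // jJ.
  by rewrite noJ ?jJ // !mul0r.
have : (- m)%:~R <= (Num.floor (ev a b))%:~R :> R.
  by rewrite ler_int floor_ge_int rmorphN /= -eqx0; lra.
by rewrite rmorphN /=; lra.
Qed.

End Enclosures.

(** * Sector germs *)

Section SectorGerms.
Variables (R : realType) (I : finType) (d : nat) (D : root_datum I d).
Variable L : kac_moody_algebra R[i] (cartan D).
Local Notation A := 'rV[R]_d.
Local Notation al j x := (ev x (rootR R D j)).
Local Notation r := (@refl R I d D).
Local Notation weyl := (@weyl R I d D).
Local Notation weyl_id := (@weyl_id R I d D).
Local Notation C := (fund_chamber D : set A).
Local Notation rho := (rho R D).
Local Notation fund_face J := (fund_face D J : set A).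
Local Notation infty := (infty D true : set_system A).
Local Notation affine_weyl := (affine_weyl D : set (A -> A)).

(** As [n] grows, these sets form a base of the germ of C at infinity, for any base point;
    statements about germs thus become statements about one real bound. *)
Definition sector (n : R) : set A := [set x | forall j, n <= al j x].

Lemma sector_face_germE x w (E : set A) : weyl w ->
  sector_face_germ x [set sgn R true *: w v | v in C] E <->
  exists n, forall y, sector n y -> E (w y).
Proof.
move=> W; have [w' [W' K K']] := weyl_inv W; split=> [[u _ uE]|[n nE]].
  have [N N0 NP] := finite_upper_bound (fun j => al j (w' (x + u))).
  exists (N + 1) => y yP; apply: uE; exists (w (y - w' (x + u))).
    exists (y - w' (x + u)); last by rewrite /sgn scale1r.
    by move=> j; rewrite evB; have := yP j; have := NP j; lra.
  by rewrite (weylB W) K' addrC subrK.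
have [t tP] := large_sector D (w' x) n.
pose s := Num.max t 1.
have s0 : 0 < s by rewrite lt_max ltr01 orbT.
exists (w (s *: rho)).
  apply: subset_closure; exists (s *: rho); last by rewrite /sgn scale1r.
  by move=> j; rewrite evZ al_rho mulr1.
move=> _ [_ [v Cv <-] <-]; rewrite /sgn scale1r.
rewrite -{1}(K' x) -!(weylD W); apply: nE => j.
have ts : t <= s by rewrite le_max lexx.
by rewrite evD; have := tP s ts j; have := Cv j; lra.
Qed.

Lemma inftyE (E : set A) : infty E <-> exists n, sector n `<=` E.
Proof. exact: (sector_face_germE 0 E weyl_id). Qed.

Lemma infty_translate (E : set A) t :
  infty [set x | E (x + t)] <-> infty E.
Proof.
suff aux (F : set A) u : infty F -> infty [set x | F (x + u)].
  split=> [/(aux _ (- t))|/aux]; last exact.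
  by under eq_set do rewrite /= subrK.
move=> /inftyE[n nF]; apply/inftyE.
have [N N0 NP] := finite_upper_bound (fun j => - al j u).
exists (n + N) => x xP; apply: nF => j; rewrite evD.
by have := xP j; have := NP j; lra.
Qed.

Lemma far_face0 a n : far_face D finset.set0 a n = sector n.
Proof. by apply/seteqP; split=> x /= xP j; have := xP j; rewrite inE. Qed.

Lemma far_face_germ0 a : far_face_germ L finset.set0 a = infty.
Proof.
apply/seteqP; split=> E.
  move=> [P [eP PE] [n nP]]; apply/inftyE; exists n.
  by rewrite -(far_face0 a); exact: subset_trans PE.
move=> /inftyE[n nE].
exists [set x | forall j, (Num.ceil n)%:~R <= al j x].
  split; first by apply: enclosed_ge; exact: all_roots_simple.
  by move=> x xP; apply: nE => j; apply: le_trans (ceil_ge _) (xP j).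
by exists (Num.ceil n)%:~R; rewrite far_face0.
Qed.

Lemma chimney_germ_chamber a :
  chimney_germ L (face L a (fund_face [set: I]%SET)) (fund_face finset.set0) = infty.
Proof. by rewrite far_face_germE far_face_germ0. Qed.

Lemma is_face_fund a J : is_face L (face L a (fund_face J)).
Proof. by exists a, true, (fund_face J); split=> //; exact: vect_face_fund. Qed.

Lemma affine_subspace_sector (S : set A) n : affine_subspace S ->
  sector n `<=` S -> S = setT.
Proof.
move=> [_ aS] nS; apply/seteqP; split=> // x _.
have [t tP] := large_sector D 0 n.
pose z : A := t *: rho.
have [t' t'P] := large_sector D (x - z) n.
pose y : A := Num.max t t' *: rho.
have zS : S z by apply: nS => j; have := tP t (lexx _) j; rewrite add0r.
have yS : S y.
  by apply: nS => j; have := tP (Num.max t t') _ j; rewrite add0r le_max lexx; exact.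
have xyS : S (x - z + y).
  by apply: nS => j; apply: t'P; rewrite le_max lexx orbT.
have := aS z (x - z + y) y 1 zS xyS yS.
by rewrite addrK scale1r addrC subrK.
Qed.

(** An affine subspace containing a sector is everything, so the pointwise stabilizer is trivial.
    Being solid allows a sector-germ to be the second filter in (MA3), next to another
    sector-germ. *)
Lemma solid_chamber a :
  solid L (face L a (fund_face [set: I]%SET)) (fund_face finset.set0).
Proof.
exists setT.
  split; first by split=> //; exists 0.
    exists (fun=> None) => //; exists setT => //.
    exists (fun=> None), (fun=> None), setT; split=> //; exact: filterT.
  move=> S aS [k [E0 [k1 [k2 [U [nU kE kU]]]] E0P] PS].
  have E0a : E0 a.
    apply/kE/kU; split; first exact: nbhs_singleton.
    by exists 0; rewrite ?addr0 //; exact: fund_face0T.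
  have [N N0 NP] := finite_upper_bound (fun j => al j a).
  rewrite (@affine_subspace_sector S (N + 1)) // => x xP; apply/PS/E0P.
  exists a => //; exists (x - a); last by rewrite addrC subrK.
  by rewrite fund_face0 => j; have := xP j; have := NP j; rewrite evB; lra.
apply: (@sub_finite_set _ _ [set id]); last exact: finite_set1.
move=> w [_ wP]; apply/funext => x; have := wP 0 x Logic.I Logic.I.
by rewrite subr0.
Qed.

Lemma coroot_latticeD (t u : A) :
  coroot_lattice D t -> coroot_lattice D u -> coroot_lattice D (t + u).
Proof.
move=> [n _ <-] [m _ <-]; exists (fun i => n i + m i) => //.
by rewrite -big_split; apply: eq_bigr => i _; rewrite mulrzDr.
Qed.

Lemma coroot_latticeN (t : A) : coroot_lattice D t -> coroot_lattice D (- t).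
Proof.
move=> [n _ <-]; exists (fun i => - n i) => //.
by rewrite -sumrN; apply: eq_bigr => i _; rewrite mulrNz.
Qed.

Lemma coroot_lattice0 : coroot_lattice D (0 : A).
Proof. by exists (fun=> 0) => //; rewrite big1. Qed.

Lemma coroot_lattice_refl i (t : A) :
  coroot_lattice D t -> coroot_lattice D (r i t).
Proof.
move=> tQ; rewrite /refl; apply: coroot_latticeD => //; apply: coroot_latticeN.
case: tQ => n _ <-; exists (fun j => (j == i)%:Z * \sum_k n k * cartan D k i) => //.
rewrite [LHS](bigD1 i) //= eqxx mul1r [X in _ + X]big1 ?addr0 => [|j ji]; last by rewrite (negPf ji) mul0r.
rewrite -scaler_int; congr (_ *: _).
rewrite /ev mulmx_suml summxE rmorph_sum; apply: eq_bigr => k _.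
rewrite -scaler_int -scalemxAl mxE -/(ev _ _) ev_coroot.
exact: intrM.
Qed.

Lemma coroot_lattice_weyl w (t : A) : weyl w ->
  coroot_lattice D t -> coroot_lattice D (w t).
Proof. by elim=> // i w' _ IH tQ; exact/coroot_lattice_refl/IH. Qed.

Lemma affine_weyl_comp g h : affine_weyl g -> affine_weyl h -> affine_weyl (g \o h).
Proof.
move=> [w [t [W tQ ->]]] [w' [t' [W' t'Q ->]]].
exists (w \o w'), (w t' + t); split.
- exact: weyl_comp.
- by apply: coroot_latticeD => //; exact: coroot_lattice_weyl.
- by apply/funext => x /=; rewrite (weylD W) addrA.
Qed.

Lemma affine_weyl_weyl w : weyl w -> affine_weyl w.
Proof.
move=> W; exists w, 0; split=> //; first exact: coroot_lattice0.
by apply/funext => x; rewrite addr0.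
Qed.

Lemma affine_weyl_inv h : affine_weyl h ->
  exists h', [/\ affine_weyl h', cancel h h' & cancel h' h].
Proof.
move=> [w [t [W tQ ->]]]; have [w' [W' K K']] := weyl_inv W.
exists (fun x => w' x - w' t); split.
- exists w', (- w' t); split=> //.
  by apply: coroot_latticeN; exact: coroot_lattice_weyl.
- by move=> x; rewrite (weylD W') K addrK.
- by move=> x; rewrite (weylB W) !K' subrK.
Qed.

Lemma affine_weyl_translation t : coroot_lattice D t -> affine_weyl (fun x => x + t).
Proof. by move=> tQ; exists id, t; split=> //; exact: weyl_id. Qed.

End SectorGerms.

(** * Charts of a masure *)

Section Charts.
Variables (R : realType) (I : finType) (d : nat) (D : root_datum I d).
Variable L : kac_moody_algebra R[i] (cartan D).
Variable M : masure L.
Local Notation A := 'rV[R]_d.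
Local Notation al j x := (ev x (rootR R D j)).
Local Notation weyl_id := (@weyl_id R I d D).
Local Notation rho := (rho R D).
Local Notation fund_face J := (fund_face D J : set A).
Local Notation infty := (infty D true : set_system A).
Local Notation affine_weyl := (affine_weyl D : set (A -> A)).
Local Notation sector := (@sector R I d D).
Local Notation point_face a := (face L a (fund_face [set: I]%SET)).

Definition chart (f : A -> M) := apt (range f) /\ isomw (range f) f.

Lemma isomw_range (B : set M) f : apt B -> isomw B f -> range f = B.
Proof.
move=> aB; have [f0 [_ fB ->]] := ma1 aB => -[w aw <-].
have [w' [_ K K']] := affine_weyl_inv aw.
rewrite -fB; apply/seteqP; split=> _ [x _ <-]; first by exists (w x).
by exists (w' x) => //=; rewrite K'.
Qed.

Lemma isomw_chart (B : set M) f : apt B -> isomw B f -> chart f.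
Proof. by move=> aB fB; rewrite /chart (isomw_range aB fB). Qed.

Lemma chart_inj f : chart f -> injective f.
Proof.
move=> [aB fB]; move: fB; have [f0 [f0i _ ->]] := ma1 aB => -[w aw <-].
have [w' [_ K _]] := affine_weyl_inv aw.
exact: inj_comp f0i (can_inj K).
Qed.

Lemma range_comp_affine (f : A -> M) h : affine_weyl h -> range (f \o h) = range f.
Proof.
move=> ah; have [h' [_ K K']] := affine_weyl_inv ah.
apply/seteqP; split=> _ [x _ <-]; first by exists (h x).
by exists (h' x) => //=; rewrite K'.
Qed.

Lemma chart_comp f h : chart f -> affine_weyl h -> chart (f \o h).
Proof.
move=> [aB fB] ah; rewrite /chart range_comp_affine //; split=> //.
move: fB; have [f0 [_ _ ->]] := ma1 aB => -[w aw <-].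
by exists (w \o h) => //; exact: affine_weyl_comp.
Qed.

Lemma chart_same_range f g : chart f -> chart g -> range f = range g ->
  exists2 h, affine_weyl h & f = g \o h.
Proof.
move=> [aB fB] [_ gB] E; move: fB gB; rewrite -E.
have [f0 [_ _ ->]] := ma1 aB => -[w aw <-] [w' aw' <-].
have [w'' [aw'' K K']] := affine_weyl_inv aw'.
exists (w'' \o w); first exact: affine_weyl_comp.
by apply/funext => x /=; rewrite K'.
Qed.

Lemma chart_cover x : exists f a, chart f /\ f a = x.
Proof.
have [B aB Bx] := apt_cover x.
have [f0 [_ fB E]] := ma1 aB.
have iB : isomw B f0.
  by rewrite E; exists id => //; apply: affine_weyl_weyl; exact: weyl_id.
by move: Bx; rewrite -fB => -[a _ <-]; exists f0, a; split=> //; exact: (isomw_chart aB).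
Qed.

Lemma transported_chart (K : set (set_system A)) f F0 : chart f -> K F0 ->
  transported K (fmap f F0).
Proof. by move=> [aB fB] KF; exists (range f), f, F0. Qed.

(** (MA4) in coordinates: the enclosure fixed by the Weyl isomorphism yields an enclosed set of the
    model on which the two charts differ by an element of W^a. *)
Lemma ma4_chart (f g : A -> M) Q F : chart f -> chart g ->
  transported (splayed_chimney_germ L) Q ->
  transported (is_face L `|` solid_chimney_germ L) F ->
  Q (range f) -> F (range f) -> Q (range g) -> F (range g) ->
  exists h P E E', [/\ affine_weyl h, enclosed L P, Q E /\ F E',
    (forall x, E (f x) \/ E' (f x) -> P x) & forall x, P x -> f x = g (h x)].
Proof.
move=> [af cf] [ag cg] tQ tF Qf Ff Qg Fg.
have [phi [_ iso [Z [k [E [E1 QE [E2 FE EE]] kE] PZ] fix_phi]]] :=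
  ma4 (m := M) tQ tF af ag cf Qf Ff Qg Fg.
have [h ah hE] := iso f g cf cg.
exists h, (f @^-1` E), E1, E2; split=> //.
- by exists k.
- by move=> x xE; rewrite /preimage /= -EE.
move=> x Px; rewrite -hE; apply/esym/fix_phi/PZ.
by rewrite -kE.
Qed.

Lemma face_mono a W (E E' : set A) : face L a W E -> E `<=` E' -> face L a W E'.
Proof.
move=> [k [k' [U [nU kE kU]]]] EE; exists k, k', U; split=> //.
exact: subset_trans EE.
Qed.

(** (MA2) for a point: two apartments sharing it share its enclosure, hence its smallest face. *)
Lemma point_face_range f g a : chart f -> chart g -> range g (f a) ->
  point_face a (f @^-1` range g).
Proof.
move=> [af cf] [ag cg] fa.
have ga : fmap f (globally [set a]) (range g) by move=> _ ->.
have [[k [Z FZ ZE] kZ] _] := ma2 (m := M) af cf (ma2_point L a) ag ga.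
have fZ : (f @^-1` Z) a by exact: FZ.
apply: (@face_mono _ _ (f @^-1` Z)).
  by rewrite ZE; apply: face_enclosed; [exists k|rewrite -ZE].
by move=> x Zx; have [] : (range f `&` range g) (f x) by apply: kZ; rewrite -ZE.
Qed.

Definition splayed_face (J : {set I}) := J = finset.set0 \/ exists i, J = finset.set1 i.

Lemma splayed_germ J f a W e : splayed_face J -> chart f -> vect_face D e W ->
  transported (splayed_chimney_germ L) (fmap f (chimney_germ L (face L a W) (fund_face J))).
Proof.
move=> sJ cf vW; apply: transported_chart => //.
exists (face L a W), true, (fund_face J); split=> //.
- by exists a, e, W.
- exact: vect_face_fund.
- by case: sJ => [->|[i ->]]; [exact: spherical_fund_chamber|exact: spherical_panel].
Qed.

Lemma infty_splayed f : chart f -> transported (splayed_chimney_germ L) (fmap f infty).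
Proof.
move=> cf; rewrite -(chimney_germ_chamber L 0).
by apply: splayed_germ => //; [left|exact: vect_face_fund].
Qed.

Lemma infty_solid f : chart f ->
  transported (is_face L `|` solid_chimney_germ L) (fmap f infty).
Proof.
move=> cf; apply: transported_chart => //; right.
exists (point_face 0), true, (fund_face finset.set0); split.
- exact: is_face_fund.
- exact: vect_face_fund.
- exact: solid_chamber.
- by rewrite chimney_germ_chamber.
Qed.

Lemma face_transported f a W e : chart f -> vect_face D e W ->
  transported (is_face L `|` solid_chimney_germ L) (fmap f (face L a W)).
Proof. by move=> cf vW; apply: transported_chart => //; left; exists a, e, W. Qed.

Lemma point_face_transported f a : chart f ->
  transported (is_face L `|` solid_chimney_germ L) (fmap f (point_face a)).
Proof. by move=> cf; apply: face_transported => //; exact: vect_face_fund. Qed.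

Lemma ma3_chart Q F : transported (splayed_chimney_germ L) Q ->
  transported (is_face L `|` solid_chimney_germ L) F ->
  exists f : A -> M, [/\ chart f, Q (range f) & F (range f)].
Proof.
move=> tQ tF; have [B [aB QB FB]] := ma3 (m := M) tQ tF.
have [f0 [_ fB E]] := ma1 aB.
have iB : isomw B f0.
  by rewrite E; exists id => //; apply: affine_weyl_weyl; exact: weyl_id.
by exists f0; rewrite fB; split=> //; exact: (isomw_chart aB).
Qed.

(** (MA4) needs a face besides the chimney germ; the smallest face at a point far along the chimney,
    lying in both apartments, serves. *)
Lemma chart_extract f g J (a : A) (W : set A) e : splayed_face J -> chart f -> chart g ->
  vect_face D e W -> (forall U, nbhs a U -> exists2 x, U x & W (x - a)) ->
  fmap f (chimney_germ L (face L a W) (fund_face J)) (range g) ->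
  exists h P E, [/\ affine_weyl h, enclosed L P,
    chimney_germ L (face L a W) (fund_face J) E, E `<=` P &
    forall x, P x -> f x = g (h x)].
Proof.
move=> sJ cf cg vW W0 Qg.
have [P [eP Pg [U [u [nU cu UP]]]]] := chimney_germ_elim Qg.
have [x0 Ux0 Wx0] := W0 _ nU.
pose v := face_point R D J.
have Vv : fund_face J v by rewrite -[v]scale1r; exact: face_point_face.
have Pp : P (x0 + u + v) by exact: UP.
have Fg : fmap f (point_face (x0 + u + v)) (range g).
  by apply: (@face_mono _ _ P) => //; exact: face_enclosed.
have frange : f @^-1` range f = setT by apply/seteqP; split=> // x _; exists x.
have [] := @ma4_chart f g _ _ cf cg (splayed_germ a sJ cf vW)
   (point_face_transported (x0 + u + v) cf) _ _ Qg Fg.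
- rewrite /fmap /= frange; move: Qg => [u' cu' [k [E1 E01 E1P] PE]].
  by exists u' => //; exists k => //; exists E1.
- rewrite /fmap /= frange; exact: face_mono Fg _.
move=> h [P' [E [E' [ah eP' [QE _] EP fP]]]].
by exists h, P', (f @^-1` E); split=> // x Ex; apply: EP; left.
Qed.

Definition toward (s : set_system M) (f : A -> M) := chart f /\ fmap f infty = s.

Lemma infty_range (f : A -> M) : fmap f infty (range f).
Proof. by apply/inftyE; exists 0 => x _; exists x. Qed.

(** By (MA4) for [s] and the smallest face of the common point, the charts differ by some w x + t on
    an enclosed set containing [a] and a deep sector. Preservation of the sector germ forces w = 1,
    and [enclosed_sector_add] extends the agreement to [a] plus the dominant cone. *)
Lemma toward_translation s f g a b : toward s f -> toward s g -> f a = g b ->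
  exists t, [/\ coroot_lattice D t, b = a + t,
    forall u, dominant D u -> f (a + u) = g (b + u) &
    exists n, forall x, sector n x -> f x = g (x + t)].
Proof.
move=> [cf fs] [cg gs] fgab.
have ga : range g (f a) by exists b.
have fa : range f (f a) by exists a.
have [] := @ma4_chart f g s (fmap f (point_face a)) cf cg.
- by rewrite -fs; exact: infty_splayed.
- exact: point_face_transported.
- by rewrite -fs; exact: infty_range.
- exact: point_face_range.
- by rewrite -gs; exact: infty_range.
- exact: point_face_range.
move=> h [P [E [E' [[w [t [W tQ hE]]] eP [QE FE] EP fP]]]].
have Pa : P a.
  apply: EP; right; have [k [k' [U [nU kE kU]]]] : point_face a (f @^-1` E') := FE.
  apply/kE/kU; split; first exact: nbhs_singleton.
  by exists 0; rewrite ?addr0 //; exact: fund_face0T.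
have [n nE] : exists n, sector n `<=` f @^-1` E.
  by apply/inftyE; move: QE; rewrite -fs.
have nP : sector n `<=` P by move=> x /nE xE; apply: EP; left.
have wid : w = id.
  have [w' [W' K K']] := weyl_inv W.
  suff w'id : w' = id by apply/funext => x; have := K x; rewrite w'id.
  apply: (weyl_id_of_dominant W') => p Cp j.
  have : fmap g infty (f @` sector n).
    by rewrite gs -fs; apply/inftyE; exists n => x xn; exists x.
  move=> /inftyE[m mP].
  have key q : sector m q -> n <= al j (w' q) - al j (w' t).
    move=> /mP[y yn]; rewrite (fP _ (nP _ yn)) => /(chart_inj cg) <-.
    by rewrite hE (weylD W') K evD addrK; exact: yn.
  have [N N0 NP] := finite_upper_bound (fun l => m / al l p).
  have sP q : N <= q -> sector m (q *: p).
    move=> Ns l; rewrite evZ; have := NP l; rewrite ler_pdivrMr //.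
    by move=> h1; apply: le_trans h1 _; rewrite ler_wpM2r // ltW.
  rewrite leNgt; apply/negP => neg.
  (* Large enough for a point far along [p] to violate the lower bound of [key] if al j were
     negative at [w' p]. *)
  pose z := `|n| + `|al j (w' t)| + 1.
  have z0 : 0 <= z by rewrite !addr_ge0.
  have Nz : N <= N + z / - al j (w' p).
    by rewrite lerDl divr_ge0 // oppr_ge0 ltW.
  have zE : z / - al j (w' p) * al j (w' p) = - z by field; rewrite lt_eqF.
  have := key _ (sP _ Nz); rewrite (weylZ W') evZ mulrDl zE.
  have := mulr_ge0_le0 N0 (ltW neg); have := ler_norm (- n).
  have := ler_norm (- al j (w' t)); rewrite !normrN /z; lra.
have ba : b = a + t.
  by apply: (chart_inj cg); rewrite -fgab fP // hE wid.
exists t; split=> //.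
  move=> u u0; rewrite fP; last exact: (enclosed_sector_add eP Pa nP u0).
  by rewrite hE wid ba addrAC.
by exists n => x xn; rewrite fP ?hE ?wid //; exact: nP.
Qed.

Lemma toward_common_sector s f g : toward s f -> toward s g ->
  exists t n, coroot_lattice D t /\ forall x, sector n x -> f x = g (x + t).
Proof.
move=> fs gs.
have : fmap f infty (range g) by rewrite fs.2 -gs.2; exact: infty_range.
move=> /inftyE[m mP]; have [t tP] := large_sector D 0 m.
have [|b _ bE] := mP (t *: rho); first by move=> j; have := tP t (lexx _) j; rewrite add0r.
have [u [uQ _ _ [n nP]]] := toward_translation fs gs (esym bE).
by exists u, n.
Qed.

Lemma toward_extract f (g : A -> M) : chart f -> chart g -> fmap f infty (range g) ->
  exists h n, [/\ affine_weyl h, toward (fmap f infty) (g \o h) &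
    forall x, sector n x -> f x = g (h x)].
Proof.
move=> cf cg fg.
have pt0 (U : set A) : nbhs (0 : A) U -> exists2 x, U x & fund_face [set: I]%SET (x - 0).
  move=> nU; exists 0; first exact: nbhs_singleton.
  by rewrite subrr; exact: fund_face0T.
have := @chart_extract f g finset.set0 0 _ true (or_introl erefl) cf cg
  (vect_face_fund R D [set: I]%SET) pt0.
rewrite chimney_germ_chamber => /(_ fg)[h [P [E [ah eP QE EP fP]]]].
move: QE => /inftyE[n nE].
have nP x : sector n x -> f x = g (h x) by move=> /nE/EP/fP.
exists h, n; split=> //; split; first exact: chart_comp.
apply/seteqP; split=> Z /inftyE[m mZ]; apply/inftyE; exists (Num.max n m) => x xP.
  have xn : sector n x by move=> j; apply: le_trans (xP j); rewrite le_max lexx.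
  have xm : sector m x by move=> j; apply: le_trans (xP j); rewrite le_max lexx orbT.
  by have := mZ _ xm; rewrite /preimage /= -nP.
have xn : sector n x by move=> j; apply: le_trans (xP j); rewrite le_max lexx.
have xm : sector m x by move=> j; apply: le_trans (xP j); rewrite le_max lexx orbT.
by have := mZ _ xm; rewrite /preimage /= nP.
Qed.

Lemma toward_through f x : chart f -> exists g a, toward (fmap f infty) g /\ g a = x.
Proof.
move=> cf; have [f0 [a0 [cf0 <-]]] := chart_cover x.
have [g [cg Qg Fg]] := ma3_chart (infty_splayed cf) (point_face_transported a0 cf0).
have [h [n [ah gs _]]] := toward_extract cf cg Qg.
have [b _ bE] : range g (f0 a0).
  have [k [k' [U [nU kE kU]]]] : point_face a0 (f0 @^-1` range g) := Fg.
  apply/kE/kU; split; first exact: nbhs_singleton.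
  by exists 0; rewrite ?addr0 //; exact: fund_face0T.
have [h' [_ K K']] := affine_weyl_inv ah.
by exists (g \o h), (h' b); split=> //=; rewrite K'.
Qed.

End Charts.

(** * Addition toward a sector germ *)

Section SectorAdd.
Variables (R : realType) (I : finType) (d : nat) (D : root_datum I d).
Variable L : kac_moody_algebra R[i] (cartan D).
Variable M : masure L.
Local Notation A := 'rV[R]_d.
Local Notation infty := (infty D true : set_system A).
Local Notation sector := (@sector R I d D).

(** Version of x +_s u with Weyl charts only; [sector_addE] shows that the larger class of
    isomorphisms gives the same relation. *)
Definition sadd (s : set_system M) x u z :=
  exists f a, [/\ toward s f, f a = x & z = f (a + u)].

Lemma sadd_fun s x u z z' : dominant D u -> sadd s x u z -> sadd s x u z' -> z = z'.
Proof.
move=> u0 [f [a [fs fa ->]]] [g [b [gs gb ->]]].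
have [t [_ _ E _]] := toward_translation fs gs (etrans fa (esym gb)).
exact: E.
Qed.

Lemma sadd_trans s x u z v z' : dominant D v ->
  sadd s x u z -> sadd s z v z' -> sadd s x (u + v) z'.
Proof.
move=> v0 [f [a [fs fa zE]]] [g [b [gs gb ->]]].
exists f, a; split=> //; rewrite addrA.
have [t [_ _ E _]] := toward_translation gs fs (etrans gb zE).
exact: E.
Qed.

Lemma sadd_total (f : A -> M) x u : chart f -> exists z, sadd (fmap f infty) x u z.
Proof.
move=> cf; have [g [a [gs ga]]] := toward_through x cf.
by exists (g (a + u)), g, a.
Qed.

Section Distance.
Variable N : A -> R.
Hypothesis norm_N : is_norm N.

(** Stronger than a bound on the infimum: it provides a pair achieving the bound, so that estimates
    compose without approximation. *)
Definition dist_le s x x' K := exists u u' z,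
  [/\ dominant D u, dominant D u', sadd s x u z, sadd s x' u' z & N u + N u' <= K].

Lemma dist_le_sym s x x' K : dist_le s x x' K -> dist_le s x' x K.
Proof. by move=> [u [u' [z [*]]]]; exists u', u, z; split=> //; rewrite addrC. Qed.

Lemma dist_leW s x x' K K' : K <= K' -> dist_le s x x' K -> dist_le s x x' K'.
Proof.
move=> KK [u [u' [z [*]]]]; exists u, u', z; split=> //.
exact: le_trans KK.
Qed.

(** Dominant additions toward one germ commute, so the two meeting points are pushed on to a common
    one, x' + (u' + v). *)
Lemma dist_le_trans (f : A -> M) x x' x'' K K' : chart f ->
  dist_le (fmap f infty) x x' K -> dist_le (fmap f infty) x' x'' K' ->
  dist_le (fmap f infty) x x'' (K + K').
Proof.
case: norm_N => ND _ _.
move=> cf [u [u' [z [u0 u'0 xz x'z uu]]]] [v [v' [z' [v0 v'0 x'z' x''z' vv]]]].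
have [y zy] := sadd_total z v cf.
have x'y := sadd_trans v0 x'z zy; rewrite addrC in x'y.
have [y' zy'] := sadd_total z' u' cf.
have yy' : y = y'.
  exact: sadd_fun (dominantD v0 u'0) x'y (sadd_trans u'0 x'z' zy').
exists (u + v), (v' + u'), y; split.
- exact: dominantD.
- exact: dominantD.
- exact: sadd_trans xz zy.
- by rewrite yy'; exact: sadd_trans x''z' zy'.
- by have := ND u v; have := ND v' u'; lra.
Qed.

Lemma dist_le_chart s f a v v' : toward s f -> dominant D v -> dominant D v' ->
  dist_le s (f a) (f (a + (v - v'))) (N v + N v').
Proof.
move=> fs v0 v'0; exists v, v', (f (a + v)); split=> //.
  by exists f, a.
by exists f, (a + (v - v')); split=> //; rewrite addrA subrK.
Qed.

End Distance.

End SectorAdd.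

(** * Adjacent sector germs *)

Lemma sgnK (R : realType) e : sgn R e * sgn R e = 1.
Proof. by rewrite /sgn; case: e; rewrite ?mulr1 ?mulrNN ?mulr1. Qed.

Lemma sgn_bound (R : realType) e (t : R) : 0 <= t -> - t <= t * sgn R e <= t.
Proof. by move=> t0; rewrite /sgn; case: e; apply/andP; split; lra. Qed.

Section Adjacent.
Variables (R : realType) (I : finType) (d : nat) (D : root_datum I d).
Variable L : kac_moody_algebra R[i] (cartan D).
Variable M : masure L.
Local Notation A := 'rV[R]_d.
Local Notation al j x := (ev x (rootR R D j)).
Local Notation r := (@refl R I d D).
Local Notation c i j := ((cartan D i j)%:~R : R).
Local Notation weyl := (@weyl R I d D).
Local Notation rho := (rho R D).
Local Notation fund_face J := (fund_face D J : set A).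
Local Notation infty := (infty D true : set_system A).
Local Notation sector := (@sector R I d D).

Variables (f : A -> M) (i : I).
Hypothesis chart_f : chart f.

Definition panel_map (k : A -> A) :=
  exists w t, (w = id \/ w = r i) /\ k = fun x => w x + t.

Lemma panel_map_weyl w : w = id \/ w = r i -> weyl w.
Proof. by case=> ->; [exact: weyl_id|exact: weyl_refl1]. Qed.

Lemma panel_map_comp k k' : panel_map k -> panel_map k' -> panel_map (k \o k').
Proof.
move=> [w [t [W ->]]] [w' [t' [W' ->]]].
exists (w \o w'), (w t' + t); split; last first.
  by apply/funext => x /=; rewrite (weylD (panel_map_weyl W)) addrA.
case: W W' => -> [->|->]; [by left|by right|by right|left].
by apply/funext => x /=; rewrite reflK.
Qed.

Lemma panel_map_translate k a v t : panel_map k ->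
  k (a + t *: v) = k a + t *: (k v - k 0).
Proof.
move=> [w [u [W ->]]]; have W' := panel_map_weyl W.
by rewrite (weylD W') (weylZ W') (weyl0 W') add0r addrK addrAC.
Qed.

Definition strip xi n : set A :=
  [set x | al i x = xi /\ forall j, j != i -> n <= al j x].

(** The base point has height [xi] because al i is 1 at rho. Far strips lie in a given sector when
    [xi] is large, and in the image of that sector under [r i] when [- xi] is large. *)
Definition panel_germ xi := far_face_germ L (finset.set1 i) (xi *: rho).

Lemma stripE xi n : far_face D (finset.set1 i) (xi *: rho) n = strip xi n.
Proof.
apply/seteqP; split=> x /= xP.
  split=> [|j ji]; first by have := xP i; rewrite inE eqxx evZ al_rho mulr1.
  by have := xP j; rewrite inE (negPf ji).
move=> j; rewrite inE; case: eqVneq => [->|ji]; last exact: xP.2.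
by rewrite evZ al_rho mulr1 xP.1.
Qed.

Lemma panel_germ_splayed xi :
  transported (splayed_chimney_germ L) (fmap f (panel_germ xi)).
Proof.
rewrite /panel_germ -far_face_germE; apply: splayed_germ => //.
  by right; exists i.
exact: vect_face_fund.
Qed.

(** The strip contains two points whose difference lies in the open panel of [i]; the linear part
    fixes this difference, and [weyl_fix_panel] concludes. *)
Lemma strip_fixed h xi n : affine_weyl D h -> (forall x, strip xi n x -> h x = x) ->
  panel_map h.
Proof.
move=> [w [t [W _ ->]]] fixh; exists w, t; split=> //.
apply: weyl_fix_panel => //; set p := face_point _ _ _.
have ap j : al j p = if j == i then 0 else 1 by rewrite al_face_point inE.
have [x xE] := simple_root_dual D (fun j => if j == i then xi else `|n| : R).
have xP : strip xi n x.
  split=> [|j ji]; rewrite xE ?eqxx //.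
  by rewrite (negPf ji) ler_norm.
have xpP : strip xi n (x + p).
  split=> [|j ji]; rewrite evD ap xE ?eqxx ?addr0 // (negPf ji).
  by have := ler_norm n; lra.
have := fixh _ xpP; rewrite (weylD W) addrAC fixh //.
by move/addrI.
Qed.

(** * Apartments containing a local face and a panel germ *)

Section LocalType.
Variables (psi : A -> M) (b u : A) (e : bool) (J : {set I}).
Hypothesis toward_psi : toward (fmap f infty) psi.
Hypothesis face_u : fund_face J u.
Local Notation dir := (sgn R e *: u).
Local Notation W := ([set sgn R e *: v | v in fund_face J] : set A).
Local Notation F := (fmap psi (face L b W)).

Lemma vect_face_sgn : vect_face D e W.
Proof. by exists id, J; split=> //; exact: weyl_id. Qed.

Lemma face_ray E : face L b W E ->
  exists2 eps, 0 < eps & forall t, 0 < t < eps -> E (b + t *: dir).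
Proof.
move=> [k [k' [U [nU kE kU]]]].
have [eps eps0 epsU] := line_near dir nU.
exists eps => // t /andP[t0 te]; apply/kE/kU; split.
  by apply: epsU; rewrite gtr0_norm.
exists (t *: dir) => //; exists (t *: u).
  move=> j; rewrite evZ; have := face_u j; case: (j \in J) => [->|uj].
    by rewrite mulr0.
  by rewrite mulr_gt0.
by rewrite !scalerA mulrC.
Qed.

Lemma F_transported : transported (is_face L `|` solid_chimney_germ L) F.
Proof. by apply: face_transported vect_face_sgn; case: toward_psi. Qed.

(* The value [t = 0] is included although the face at [b] need not contain [b]. *)
Definition panel_type (g : A -> M) := exists k eps, [/\ panel_map k, 0 < eps &
  forall t, 0 <= t < eps -> psi (b + t *: dir) = g (k (b + t *: dir))].

(** Agreement with [f] far along the strip normalises the chart: a transition map between two such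
    charts fixes a strip pointwise. *)
Definition meets_strip xi (g : A -> M) :=
  [/\ chart g, F (range g), fmap f (panel_germ xi) (range g) &
      exists n, forall x, strip xi n x -> g x = f x].

(* MA4 for the panel germ and the face: the transition map fixes a strip, and it
   extends to [b] because enclosed sets are closed. *)
Lemma panel_type_transfer xi g1 g2 : meets_strip xi g1 -> meets_strip xi g2 ->
  panel_type g1 -> panel_type g2.
Proof.
move=> [c1 F1 Q1 [n1 f1]] [c2 F2 Q2 [n2 f2]] [k [eps [kp eps0 kE]]].
have [h [P [E [E' [ah eP [QE FE] EP gP]]]]] :=
  ma4_chart c1 c2 (panel_germ_splayed xi) F_transported Q1 F1 Q2 F2.
have [eps' eps'0 E'P] := face_ray FE.
pose m := Num.min eps eps'.
have m0 : 0 < m by rewrite lt_min eps0.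
have mm t : t < m -> t < eps /\ t < eps' by rewrite lt_min => /andP[].
have inP t : 0 < t < m -> P (k (b + t *: dir)).
  move=> /andP[t0 /mm[te te']]; apply: EP; right.
  have t_eps : 0 <= t < eps by rewrite ltW.
  by rewrite -kE //; apply: E'P; rewrite t0.
have Pkb : P (k b).
  apply: (enclosed_limit (v := k dir - k 0) eP m0) => t tm.
  by rewrite -panel_map_translate //; exact: inP.
have Zh : exists n, forall x, strip xi n x -> h x = x.
  have [P1 [_ P1E] [n nP1]] : panel_germ xi (f @^-1` E) by [].
  rewrite stripE in nP1.
  exists (Num.max n (Num.max n1 n2)) => x [xi_x xn].
  have xle q : q <= Num.max n (Num.max n1 n2) -> strip xi q x.
    by move=> qm; split=> // j ji; apply: le_trans qm (xn j ji).
  have x0 : strip xi n x by apply: xle; rewrite le_max lexx.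
  have x1 : strip xi n1 x by apply: xle; rewrite !le_max lexx !orbT.
  have x2 : strip xi n2 x by apply: xle; rewrite !le_max lexx !orbT.
  have Px : P x by apply: EP; left; rewrite f1 //; exact/P1E/nP1.
  by apply: (chart_inj c2); rewrite -gP // f1 // f2.
have [n Zh'] := Zh.
exists (h \o k), m; split=> //; first exact: panel_map_comp (strip_fixed ah Zh') kp.
move=> t /andP[t0 tm]; have [te _] := mm t tm.
rewrite kE ?t0 //= gP //.
move: t0; rewrite le_eqVlt => /orP[/eqP <-|t0]; first by rewrite scale0r addr0.
by apply: inP; rewrite t0.
Qed.

Definition all_panel_type xi := forall g, meets_strip xi g -> panel_type g.

(* [g] is taken through the germ of the chimney of an open local face at height [xi]. *)
Lemma strip_neighbourhood xi e' : exists2 eps, 0 < eps &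
  exists g, forall xi', 0 <= sgn R e' * (xi' - xi) < eps -> meets_strip xi' g.
Proof.
(* An open cone: points of [xi *: rho + V] have heights strictly on the side [e'] of [xi], so one
   chimney covers all nearby heights of that side. *)
pose V : set A := [set sgn R e' *: v | v in fund_chamber D].
have vV : vect_face D e' V.
  by exists id, finset.set0; rewrite fund_face0; split=> //; exact: weyl_id.
have sJ : splayed_face (finset.set1 i) by right; exists i.
have ss := sgnK R e'.
have Vrho t : 0 < t -> V (t *: (sgn R e' *: rho)).
  move=> t0; exists (t *: rho); last by rewrite !scalerA mulrC.
  by move=> j; rewrite evZ al_rho mulr1.
have Vnear (U : set A) : nbhs (xi *: rho) U -> exists2 x, U x & V (x - xi *: rho).
  move=> /line_near - /(_ (sgn R e' *: rho))[eps eps0 epsU].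
  exists (xi *: rho + (eps / 2) *: (sgn R e' *: rho)).
    by apply: epsU; rewrite gtr0_norm; lra.
  by rewrite addrC addKr; apply: Vrho; lra.
have [g [cg Qg Fg]] := ma3_chart (splayed_germ (xi *: rho) sJ chart_f vV) F_transported.
have [h [P [E [ah _ QE EP fP]]]] := chart_extract sJ chart_f cg vV Vnear Qg.
have [P1 [eP1 P1E [U [v [nU cv UP1]]]]] := chimney_germ_elim QE.
have [eps eps0 epsU] := line_near (sgn R e' *: rho) nU.
have [N N0 NP] := finite_upper_bound (fun j => al j v).
pose m := Num.min eps 1.
have m0 : 0 < m by rewrite lt_min eps0 ltr01.
have mm t : t < m -> t < eps /\ t < 1 by rewrite lt_min => /andP[].
have aiv : al i v = 0 by have := closure_face cv i; rewrite inE eqxx.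
(* For [j] other than [i], the base point has al j at most [|xi| + 1] and the shift [v] at most [N];
   one more unit gives strict inequality. *)
pose n := `|xi| + N + 2.
have shift xi' : xi' = xi + sgn R e' * (xi' - xi) * sgn R e'.
  by rewrite mulrAC ss mul1r addrC subrK.
have open xi' : 0 < sgn R e' * (xi' - xi) < m -> strip xi' n `<=` P1.
  move=> /andP[]; have := shift xi'.
  set t := sgn R e' * _ => xi'E t0 /mm[te t1] x [xix xn].
  have -> : x = xi' *: rho + v + (x - (xi' *: rho + v)) by rewrite addrC subrK.
  have xi'v : xi' *: rho = xi *: rho + t *: (sgn R e' *: rho).
    by rewrite xi'E !scalerDl !scalerA.
  have xi'1 : xi' <= `|xi| + 1.
    rewrite xi'E; have := ler_norm xi; have /andP[_] := sgn_bound e' (ltW t0); lra.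
  apply: UP1.
  - by rewrite xi'v; apply: epsU; rewrite gtr0_norm.
  - by rewrite xi'v addrC addKr; exact: Vrho.
  move=> j; rewrite inE !evE al_rho mulr1; case: eqVneq => [->|ji].
    by rewrite aiv xix addr0 subrr.
  by have := xn j ji; have := NP j; rewrite /n; lra.
(* Height [xi] itself is a limit of open heights. The approach along rho changes al j by less than
   1, hence the bound [n + 1]. *)
have closed xi' : 0 <= sgn R e' * (xi' - xi) < m -> strip xi' (n + 1) `<=` P1.
  move=> /andP[]; rewrite le_eqVlt => /orP[/eqP t0 _|t0 tm]; last first.
    move=> x [xix xn]; apply: (open xi'); first by rewrite t0.
    by split=> // j ji; have := xn j ji; lra.
  have -> : xi' = xi by rewrite (shift xi') -t0 mul0r addr0.
  move=> x [xix xn]; apply: (enclosed_limit (v := sgn R e' *: rho) eP1 m0).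
  move=> t /andP[t0' tm]; apply: (open (xi + t * sgn R e')).
    by rewrite addrC addKr mulrCA ss mulr1 t0'.
  split=> [|j ji]; rewrite !evE al_rho mulr1 ?xix //.
  have [_ t1] := mm t tm; have := xn j ji.
  have /andP[] := sgn_bound e' (ltW t0'); lra.
exists m => //; exists (g \o h) => xi' /closed cl; split.
- exact: chart_comp.
- by rewrite range_comp_affine.
- exists P1; last by exists (n + 1); rewrite stripE.
  split=> // x /P1E/EP Px; rewrite range_comp_affine // /preimage /= fP //.
  by exists (h x).
- by exists (n + 1) => x /cl/P1E/EP Px; rewrite /= -fP.
Qed.

(** On each side of a height, one chart [g] meets every nearby strip, that height included, and by
    [panel_type_transfer] the type of [g] decides the property at all of them. *)
Lemma all_panel_type_const xi xi' : xi <= xi' ->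
  all_panel_type xi <-> all_panel_type xi'.
Proof.
move: xi xi'; apply: local_to_global => [p q s _ _ -> //|xi].
have half e' : exists2 eps, 0 < eps & forall xi', 0 <= sgn R e' * (xi' - xi) < eps ->
    all_panel_type xi <-> all_panel_type xi'.
  have [eps eps0 [g gP]] := strip_neighbourhood xi e'.
  have same xi' : 0 <= sgn R e' * (xi' - xi) < eps ->
      all_panel_type xi' <-> panel_type g.
    move=> /gP gxi'; split=> [|ag g' g'xi']; first exact.
    exact: panel_type_transfer gxi' g'xi' ag.
  exists eps => // xi' /same ->; apply: same.
  by rewrite subrr mulr0 lexx.
have [eps1 eps10 h1] := half true.
have [eps2 eps20 h2] := half false.
exists (Num.min eps1 eps2); first by rewrite lt_min eps10.
move=> t /andP[t0]; rewrite lt_min => /andP[t1 t2]; split.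
  by apply: iff_sym; apply: h2; rewrite /sgn; apply/andP; split; lra.
by apply: h1; rewrite /sgn; apply/andP; split; lra.
Qed.

(* High strips lie in the apartment of [psi] itself. *)
Lemma all_panel_type_high : exists xi, all_panel_type xi.
Proof.
have [t [n [tQ tP]]] := toward_common_sector (conj chart_f erefl) toward_psi.
have at_ := affine_weyl_translation (D := D) tQ.
pose g := psi \o (fun x => x + t).
have cpsi : chart psi by case: toward_psi.
have rg : range g = range psi by exact: range_comp_affine.
pose xi : R := (Num.ceil n)%:~R.
have nxi : n <= xi by exact: ceil_ge.
have sec x : strip xi xi x -> sector xi x.
  by move=> [xix xn] j; have [->|/xn//] := eqVneq j i; rewrite xix.
have sec' x : sector xi x -> sector n x by move=> xx j; exact: le_trans (xx j).
exists xi => g' g'P; apply: panel_type_transfer g'P _.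
  split; [exact: (chart_comp cpsi at_)| | |].
  - rewrite rg; exists (fun=> None), (fun=> None), setT; split=> //.
    - exact: filterT.
    - by move=> x _; exists x.
  - rewrite rg; exists (sector xi); last by exists xi; rewrite stripE.
    split; first by apply: enclosed_ge; exact: all_roots_simple.
    by move=> x /sec'/tP xE; rewrite /preimage /= xE; exists (x + t).
  - by exists xi => x /sec/sec'/tP.
exists (fun x => x - t), 1; split=> //; first by exists id, (- t); split=> //; left.
by move=> s _; rewrite /g /= subrK.
Qed.

Lemma all_panel_typeP xi : all_panel_type xi.
Proof.
have [xi0 P0] := all_panel_type_high.
by have [/all_panel_type_const ->//|/ltW/all_panel_type_const <-] := leP xi xi0.
Qed.

(* Low strips lie in every apartment containing the adjacent sector germ. *)
Lemma adjacent_local_type : exists g w t eps,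
  [/\ toward (fmap (f \o r i) infty) g, w = id \/ w = r i, 0 < eps &
   forall tau, 0 <= tau < eps ->
     psi (b + tau *: dir) = g (w b + t + tau *: w dir)].
Proof.
have cfr : chart (f \o r i).
  by apply: chart_comp => //; apply: affine_weyl_weyl; exact: weyl_refl1.
have [g [cg Qg Fg]] := ma3_chart (infty_splayed cfr) F_transported.
have [h [n [ah gs fP]]] := toward_extract cfr cg Qg.
have ar : affine_weyl D (r i : A -> A) by apply: affine_weyl_weyl; exact: weyl_refl1.
(* [g \o h] agrees with [f \o r i] on a sector; precomposing with [r i] gives agreement with [f] on
   the reflected sector [P], as [meets_strip] requires. *)
pose g' := (g \o h) \o r i.
pose m := Num.ceil n.
have nm : n <= m%:~R by exact: ceil_ge.
pose P : set A := [set x | forall j, m%:~R <= ev x (rootR R D j - c i j *: rootR R D i)].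
have PE x : P x -> sector n (r i x).
  by move=> Px j; rewrite -ev_refl_root; exact: le_trans (Px j).
have fg' x : P x -> g' x = f x.
  by move=> /PE/fP /=; rewrite reflK => ->.
(* At height [- m], the reflection lowers al j by [(- m) * c i j]; [N] bounds these losses. *)
have [N N0 NP] := finite_upper_bound (fun j => (- m)%:~R * c i j).
have ZP x : strip (- m)%:~R (m%:~R + N) x -> P x.
  move=> [xix xn] j; rewrite ev_refl_root.
  have [->|ji] := eqVneq j i; first by rewrite ev_refl_same xix intrN opprK.
  by rewrite ev_refl xix; have := xn j ji; have := NP j; lra.
have [k [eps [[w [t [wid ->]]] eps0 kE]]] : panel_type g'.
  apply: (@all_panel_typeP (- m)%:~R); split.
  - by apply: chart_comp => //; case: gs.
  - by rewrite /g' !range_comp_affine.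
  - rewrite /g' !range_comp_affine //; exists P; last first.
      by exists (m%:~R + N); rewrite stripE.
    split; first by apply: enclosed_ge => j; exact: all_roots_refl.
    move=> x /fg' xE; rewrite /preimage /= -xE /g' /=; by eexists.
  - by exists (m%:~R + N) => x /ZP/fg'.
have W := panel_map_weyl wid.
exists (g \o h), (r i \o w), (r i t), eps; split=> //.
  case: wid => ->; [by right|left].
  by apply/funext => x /=; rewrite reflK.
move=> tau /kE ->; rewrite /g' /= (weylD W) !(weylZ W) !reflD !reflZ.
by congr (g (h _)); rewrite addrAC.
Qed.

End LocalType.

Section Lipschitz.
Variable N : A -> R.
Hypothesis norm_N : is_norm N.

Lemma norm_ge0 x : 0 <= N x.
Proof.
case: norm_N => ND NZ _; have := ND x (- x); rewrite subrr -scaleN1r NZ normrN1.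
by have := NZ 0 0; rewrite scale0r normr0; lra.
Qed.

Lemma norm0 : N 0 = 0.
Proof. by case: norm_N => _ NZ _; have := NZ 0 0; rewrite scale0r normr0 mul0r. Qed.

(** In r_i u = u - al i u * cor i, the same multiple of rho is added to both terms, large enough to
    make the coroot dominant. Since al i u is at most a constant times N u, the cost is linear. *)
Lemma panel_decomposition : exists2 K, 0 < K & forall w u,
  w = id \/ w = r i -> dominant D u -> exists v v',
  [/\ dominant D v, dominant D v', w u = v - v' & N v + N v' <= K * N u].
Proof.
have [ND NZ _] := norm_N.
have [K1 K10 K1P] := norm_bound (rootR R D i) norm_N.
have [t tP] := large_sector D (corootR R D i) 0.
pose s := Num.max t 0.
have s0 : 0 <= s by rewrite le_max lexx orbT.
pose q : A := s *: rho.
pose p := corootR R D i + q.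
have q0 : dominant D q by move=> j; rewrite evZ al_rho mulr1.
have p0 : dominant D p by apply: tP; rewrite le_max lexx.
have Np := norm_ge0 p; have Nq := norm_ge0 q.
exists (1 + K1 * (N p + N q)).
  by rewrite ltr_pwDl // mulr_ge0 ?addr_ge0 // ltW.
move=> w u [->|->] u0.
  exists u, 0; split=> //; [exact: dominant0|by rewrite subr0|].
  rewrite norm0 addr0 mulrDl mul1r lerDl mulr_ge0 ?norm_ge0 //.
  by rewrite mulr_ge0 ?addr_ge0 // ltW.
have a0 := u0 i.
exists (u + al i u *: q), (al i u *: p); split.
- by apply: dominantD => //; exact: dominantZ.
- exact: dominantZ.
- by rewrite /refl /p scalerDr opprD addrACA subrr addr0.
have h1 := ND u (al i u *: q).
have h2 := K1P u; rewrite (ger0_norm a0) in h2.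
have Na x : N (al i u *: x) = al i u * N x by rewrite NZ ger0_norm.
rewrite Na in h1; rewrite Na.
have h3 : al i u * (N p + N q) <= K1 * N u * (N p + N q).
  by rewrite ler_wpM2r // addr_ge0.
lra.
Qed.

(** The length of the steps varies along the path, but the constant depends only on [i] and the
    norm, which is all that Cousin's lemma needs. *)
Lemma adjacent_segment : exists2 K, 0 < K & forall psi b u,
  toward (fmap f infty) psi -> dominant D u ->
  dist_le N (fmap (f \o r i) infty) (psi b) (psi (b + u)) (K * N u).
Proof.
have [_ NZ _] := norm_N.
have cfr : chart (f \o r i).
  by apply: chart_comp => //; apply: affine_weyl_weyl; exact: weyl_refl1.
have [K K0 KP] := panel_decomposition.
exists K => // psi b u psi_s u0.
(* Type of the vectorial face containing [u]: the local face must have the exact direction of the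
   path, which may be singular. *)
pose J := [set j | al j u == 0]%SET.
have uJ : fund_face J u.
  move=> j; rewrite inE; case: eqVneq => // uj.
  by rewrite lt_neqAle eq_sym uj u0.
suff : dist_le N (fmap (f \o r i) infty) (psi (b + 0 *: u)) (psi (b + 1 *: u))
    (K * N u * (1 - 0)).
  by rewrite scale0r addr0 scale1r subr0 mulr1.
apply: (@local_to_global R (fun t t' => dist_le N (fmap (f \o r i) infty)
  (psi (b + t *: u)) (psi (b + t' *: u)) (K * N u * (t' - t)))) => //.
  move=> t t' t'' _ _ tt' t't''.
  have -> : K * N u * (t'' - t) = K * N u * (t' - t) + K * N u * (t'' - t') by ring.
  exact: (dist_le_trans norm_N cfr tt' t't'').
move=> t.
(* The forward and the backward germs of the path belong to different local faces, each with its own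
   apartment. *)
have half e : exists2 eps, 0 < eps & forall s, 0 <= s < eps ->
    dist_le N (fmap (f \o r i) infty) (psi (b + t *: u))
      (psi (b + t *: u + s *: (sgn R e *: u))) (K * N u * s).
  have [g [w [q [eps [gs wid eps0 gE]]]]] :=
    adjacent_local_type (b + t *: u) e psi_s uJ.
  have W := panel_map_weyl wid.
  exists eps => // s s_eps; have /andP[s0 _] := s_eps.
  have e00 : 0 <= (0 : R) < eps by rewrite lexx.
  have := gE 0 e00; rewrite !scale0r !addr0 => ->; rewrite gE //.
  have [v [v' [v0 v'0 wE le]]] := KP w u wid u0.
  have le' : N (s *: v) + N (s *: v') <= K * N u * s.
    by rewrite !NZ ger0_norm // -mulrDr mulrC ler_wpM2r.
  have sv0 : dominant D (s *: v) by exact: dominantZ.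
  have sv'0 : dominant D (s *: v') by exact: dominantZ.
  rewrite (weylZ W) wE /sgn; case: e {gE}.
    rewrite scale1r scalerBr.
    by apply: dist_leW le' _; exact: dist_le_chart.
  rewrite scaleN1r opprB scalerBr; rewrite addrC in le'.
  by apply: dist_leW le' _; exact: dist_le_chart.
have [eps1 eps10 h1] := half true.
have [eps2 eps20 h2] := half false.
exists (Num.min eps1 eps2); first by rewrite lt_min eps10.
move=> s /andP[s0]; rewrite lt_min => /andP[s1 s2]; split.
  have := h2 s; rewrite s0 s2 => /(_ isT)/dist_le_sym.
  by rewrite /sgn scaleN1r scalerN -addrA -scalerBl subKr.
have := h1 s; rewrite s0 s1 => /(_ isT).
by rewrite /sgn scale1r -addrA -scalerDl addrAC subrr add0r.
Qed.

Lemma adjacent_lipschitz : exists2 K, 0 < K & forall x x' k,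
  dist_le N (fmap f infty) x x' k -> dist_le N (fmap (f \o r i) infty) x x' (K * k).
Proof.
have cfr : chart (f \o r i).
  by apply: chart_comp => //; apply: affine_weyl_weyl; exact: weyl_refl1.
have [K K0 KP] := adjacent_segment; exists K => // x x' k.
move=> [u [u' [z [u0 u'0 [g [a [gs ga zE]]] [g' [a' [gs' ga' zE']]] le]]]].
have h := KP g a u gs u0; have h' := KP g' a' u' gs' u'0.
rewrite ga -zE in h; rewrite ga' -zE' in h'.
apply: (@dist_leW _ _ _ _ _ _ N _ _ _ (K * N u + K * N u')).
  by rewrite -mulrDr ler_wpM2l // ltW.
by apply: (dist_le_trans norm_N cfr h); exact: dist_le_sym.
Qed.

End Lipschitz.

End Adjacent.

(** * Galleries and the group action *)

Section MainProof.
Variables (R : realType) (I : finType) (d : nat) (D : root_datum I d).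
Variable L : kac_moody_algebra R[i] (cartan D).
Variable M : masure L.
Local Notation A := 'rV[R]_d.
Local Notation r := (@refl R I d D).
Local Notation weyl := (@weyl R I d D).
Local Notation rho := (rho R D).
Local Notation infty := (infty D true : set_system A).
Local Notation sector := (@sector R I d D).

Lemma fmap_infty_translate (f : A -> M) t :
  fmap (fun x => f (x + t)) infty = fmap f infty.
Proof.
apply/seteqP; split=> E; rewrite /fmap /=.
  by move/(infty_translate D (f @^-1` E) t).
by move=> h; apply/(infty_translate D (f @^-1` E) t).
Qed.

Lemma affine_translation_form w t : weyl w ->
  exists t', (fun x => w x + t) = (fun x => w (x + t')).
Proof.
move=> W; have [w' [_ _ K']] := weyl_inv W; exists (w' t).
by apply/funext => x; rewrite (weylD W) K'.
Qed.

Lemma chart_weyl (f : A -> M) w : chart f -> weyl w -> chart (f \o w).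
Proof. by move=> cf W; apply: chart_comp => //; exact: affine_weyl_weyl. Qed.

Lemma sector_germ_chart s : sector_germ (M := M) true s ->
  exists f : A -> M, toward s f.
Proof.
move=> [B [f [F0 [aB fB [x [V [[w [W ->]] ->]]] ->]]]].
exists (f \o w); split; first exact: chart_weyl (isomw_chart aB fB) W.
apply/seteqP; split=> E.
  by move=> /inftyE h; apply/sector_face_germE.
by move=> /(sector_face_germE _ _ W) h; apply/inftyE.
Qed.

Section Norm.
Variable N : A -> R.
Hypothesis norm_N : is_norm N.

(** Induction over all charts at once: f \o (r_i \o w') is (f \o r_i) \o w', so each letter is a
    step between adjacent germs of the current chart. *)
Lemma gallery_lipschitz w : weyl w -> forall f : A -> M, chart f ->
  exists2 K, 0 < K & forall x x' k,
    dist_le N (fmap f infty) x x' k -> dist_le N (fmap (f \o w) infty) x x' (K * k).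
Proof.
elim=> [|i w' W' IH] f cf; first by exists 1 => // x x' k; rewrite mul1r.
have cfr : chart (f \o r i) by apply: chart_weyl => //; exact: weyl_refl1.
have [K K0 KP] := adjacent_lipschitz i cf norm_N.
have [K' K'0 K'P] := IH _ cfr.
exists (K' * K); first exact: mulr_gt0.
by move=> x x' k /KP/K'P; rewrite mulrA.
Qed.

Lemma sector_germs_lipschitz (f g : A -> M) : chart f -> chart g ->
  exists2 K, 0 < K & forall x x' k,
    dist_le N (fmap f infty) x x' k -> dist_le N (fmap g infty) x x' (K * k).
Proof.
move=> cf cg.
have [p [cp fp gp]] := ma3_chart (infty_splayed cf) (infty_solid cg).
have [h [n [ah [ch <-] _]]] := toward_extract cf cp fp.
have [h' [n' [ah' [ch' <-] _]]] := toward_extract cg cp gp.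
have [|k [w [t [W _ kE]]] hE] := chart_same_range ch' ch.
  by rewrite !range_comp_affine.
have [t' tE] := affine_translation_form t W.
have -> : fmap (p \o h') infty = fmap ((p \o h) \o w) infty.
  by rewrite hE kE tE; exact: (fmap_infty_translate ((p \o h) \o w)).
exact: gallery_lipschitz.
Qed.

End Norm.

Lemma aut_apartment_id : aut_apartment D (id : A -> A).
Proof.
exists 1%:M, 0; split; first exact: unitmx1.
  by apply/funext => x; rewrite mulmx1 addr0.
apply/seteqP; split=> [_ [q qW <-]|q qW].
  by rewrite image_id mulmx1 -surjective_pairing.
by exists q => //; rewrite image_id mulmx1 -surjective_pairing.
Qed.

(** An isomorphism may have a translation outside the coroot lattice. Written as w (x + t'), it is a
    Weyl chart preceded by a translation, which changes neither the germ at infinity nor the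
    result. *)
Lemma sector_addE s (x : M) u z : sector_add true s x u z <-> sadd s x u z.
Proof.
split=> [[B [psi [a [aB sB [f [h [fB [[w [t [W _ hE]]] _] psiE]]] psi_s [ax ->]]]]]|].
  have [t' tE] := affine_translation_form t W.
  have psiE' : psi = fun y => (f \o w) (y + t') by rewrite psiE hE tE.
  exists (f \o w), (a + t'); split.
  - split; first exact: chart_weyl (isomw_chart aB fB) W.
    by rewrite -psi_s psiE' fmap_infty_translate.
  - by rewrite -ax psiE'.
  - by rewrite psiE' /sgn scale1r addrAC.
move=> [f [a [[cf fs] fa ->]]]; have [af fB] := cf.
exists (range f), f, a; split=> //; last by rewrite /sgn scale1r.
  by rewrite -fs; exact: infty_range.
exists f, id; split=> //; split; last exact: aut_apartment_id.
exists id, 0; split=> //; first exact: weyl_id.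
by apply/funext => y; rewrite addr0.
Qed.

Lemma U_setE s (x x' : M) p : U_set true s x x' p <->
  [/\ dominant D p.1, dominant D p.2 & exists2 z, sadd s x p.1 z & sadd s x' p.2 z].
Proof.
split=> -[/closure_chamber u0 /closure_chamber u'0 [z /sector_addE xz /sector_addE x'z]];
by split=> //; exists z.
Qed.

Lemma U_set_nonempty (f : A -> M) x x' : chart f ->
  exists p, U_set true (fmap f infty) x x' p.
Proof.
move=> cf; have [g [a [gs ga]]] := toward_through x cf.
have [g' [a' [gs' ga']]] := toward_through x' cf.
have [t [n [_ gg']]] := toward_common_sector gs gs'.
have [t1 h1] := large_sector D 0 n.
have [t2 h2] := large_sector D (- a) 0.
have [t3 h3] := large_sector D (t - a') 0.
(* The three bounds put [y] in the common sector and make the two increments from [a] and [a']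
   dominant. *)
pose m := Num.max t1 (Num.max t2 t3); pose y : A := m *: rho.
have m1 : t1 <= m by rewrite le_max lexx.
have m2 : t2 <= m by rewrite !le_max lexx !orbT.
have m3 : t3 <= m by rewrite !le_max lexx !orbT.
have yn : sector n y by move=> j; have := h1 m m1 j; rewrite add0r.
exists (- a + y, t - a' + y); apply/U_setE; split=> [||].
- exact: h2.
- exact: h3.
exists (g y); first by exists g, a; split=> //=; rewrite addNKr.
exists g', a'; split=> //=; rewrite gg' //; congr g'.
by rewrite addrA addrCA subrr addr0 addrC.
Qed.

Section Action.
Variables (G : groupType) (act : G -> M -> M).
Hypothesis act_st : strongly_transitive act.

(** The linear part of the isomorphism induced by [g] is absorbed into the chart; its translation
    need not be in the coroot lattice and is kept apart as [t]. *)
Lemma toward_act g s f : toward s f ->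
  exists f' t, toward (fmap (act g) s) f' /\ forall x, act g (f x) = f' (x + t).
Proof.
move=> [[af fB] fs]; have ag := act_apt act_st g af.
have [f0 [_ f0B E]] := ma1 ag.
have i0 : isomw (act g @` range f) f0.
  by rewrite E; exists id => //; apply: affine_weyl_weyl; exact: weyl_id.
have [h [[w [t [W _ hE]]] _] gf] := act_iso act_st (g := g) af fB i0.
have [t' tE] := affine_translation_form t W.
have hE' : h = fun x => w (x + t') by rewrite hE.
have actE x : act g (f x) = (f0 \o w) (x + t') by rewrite gf hE'.
exists (f0 \o w), t'; split=> //; split.
  exact: chart_weyl (isomw_chart ag i0) W.
rewrite -(fmap_infty_translate _ t') -fs.
have -> : (fun x => (f0 \o w) (x + t')) = act g \o f by apply/funext => x; rewrite -actE.
by [].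
Qed.

Lemma dist_le_act N g s x x' k : dist_le N s x x' k ->
  dist_le N (fmap (act g) s) (act g x) (act g x') k.
Proof.
have act_add y u z : sadd s y u z -> sadd (fmap (act g) s) (act g y) u (act g z).
  move=> [f [a [fs <- ->]]]; have [f' [t [f's E]]] := toward_act g fs.
  by exists f', (a + t); split=> //; rewrite E addrAC.
move=> [u [u' [z [u0 u'0 xz x'z le]]]].
by exists u, u', (act g z); split=> //; exact: act_add.
Qed.

End Action.

End MainProof.

Theorem theorem41 (R : realType) (I : finType) (d : nat) (D : root_datum I d)
    (L : kac_moody_algebra R[i] (cartan D)) (M : masure L)
    (M_thick : thick_locally_finite M)
    (G : groupType) (act : G -> M -> M) (act_st : strongly_transitive act)
    (A0 : set M) (iota : 'rV[R]_d -> M)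
    (A0_apt : apt A0) (iota_isom : isomw A0 iota)
    (A0_stab : stabilizer_induces_WY act A0 iota)
    (g : G) (theta : ('rV[R]_d -> R) * set_system M) (theta_pos : Theta true theta) :
  exists K : R, forall x x' : M,
    dist true theta (act g x) (act g x') <= K * dist true theta x x'.
Proof.
case: theta theta_pos => N s [/= norm_N /sector_germ_chart[f fs]].
have [cf fsE] := fs.
have [f' [_ [[cf' f'sE] _]]] := toward_act act_st g fs.
(* The comparison goes from g s back to s, because [dist_le_act] gives estimates toward g s. *)
have [K K0 KP] := sector_germs_lipschitz norm_N cf' cf.
rewrite f'sE fsE in KP.
exists K => x x'; rewrite -ler_pdivrMl //.
(* Nonemptiness comes first, as the infimum of the empty set would be a default value. *)
apply: lb_le_inf.
  have [p pU] := U_set_nonempty x x' cf; rewrite fsE in pU.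
  by exists (N p.1 + N p.2), p.
move=> _ [p /U_setE[p1 p2 [z xz x'z]] <-] /=.
have : dist_le N s x x' (N p.1 + N p.2) by exists p.1, p.2, z.
move=> /(dist_le_act act_st g)/KP[u [u' [z' [u0 u'0 gz gz' le]]]].
rewrite ler_pdivrMl //; apply: le_trans le.
apply: ge_inf.
  exists 0 => _ [q _ <-] /=; exact: addr_ge0 (norm_ge0 norm_N _) (norm_ge0 norm_N _).
by exists (u, u') => //; apply/U_setE; split=> //; exists z'.
Qed.
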